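(* Let $k$ be an infinite perfect field, let $I\subseteq k[x_0,\ldots,x_n]$ be a homogeneous unmixed radical ideal of dimension $d$, with $d\ge0$, and let $F\in k[x_0,\ldots,x_n]$ be a homogeneous polynomial which is a non-zero-divisor modulo $I$. Then there exist homogeneous polynomials $f_1,\ldots,f_{n-d}\in I$ such that $F,f_1,\ldots,f_{n-d}$ is a regular sequence in $k[x_0,\ldots,x_n]$ and \[\deg f_i\le\deg I+\deg F-1\ \text{ if } d=0,\qquad \deg f_i\le 5\,d\,\deg F\,\deg I\ \text{ if } d\ge1.\]
   Context: An ideal is unmixed if all its associated primes have the same dimension. The dimension of a homogeneous ideal is the dimension of the projective variety it defines in $\mathbb P^n(\bar k)$. If $I$ has dimension $d\ge0$ and Hilbert polynomial (of $m\mapsto\dim_k(k[x_0,\ldots,x_n]/I)_m$) with leading term $a_dt^d$, then $\deg I:=d!\,a_d$. *)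

(* Defs.v *)
From HB Require Import structures.
From mathcomp Require Import all_boot all_order all_algebra.
From mathcomp Require Import mpoly.
Set Implicit Arguments. Unset Strict Implicit. Unset Printing Implicit Defensive.
Import Order.TTheory GRing.Theory.
Local Open Scope ring_scope.

Section RingNotions.
Variable R : comRingType.
Implicit Types (I J P Q : R -> Prop) (f g : R).

Definition is_ideal I : Prop :=
  [/\ I 0, (forall f g, I f -> I g -> I (f + g)) & (forall r f, I f -> I (r * f))].

Definition is_prime I : Prop :=
  [/\ is_ideal I, ~ I 1 & forall f g, I (f * g) -> I f \/ I g].

Definition is_radical I : Prop := forall f m, I (f ^+ m) -> I f.

Definition gen_ideal (gs : seq R) : R -> Prop :=
  fun p => exists a : 'I_(size gs) -> R, p = \sum_(i < size gs) a i * gs`_i.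

Definition nzd_mod (J : R -> Prop) F : Prop := forall g, J (F * g) -> J g.

Definition regular_seq (s : seq R) : Prop :=
  forall i, (i < size s)%N -> nzd_mod (gen_ideal (take i s)) s`_i.

Definition assoc_prime I P : Prop :=
  is_prime P /\ exists g, forall f, P f <-> I (f * g).

Definition subideal I J := forall f, I f -> J f.

Definition prime_chain J (r : nat) (C : nat -> R -> Prop) : Prop :=
  [/\ subideal J (C 0%N),
      (forall i, (i <= r)%N -> is_prime (C i)) &
      (forall i, (i < r)%N -> subideal (C i) (C i.+1) /\ ~ subideal (C i.+1) (C i))].

Definition krull_dim_quot J (r : nat) : Prop :=
  (exists C, prime_chain J r C) /\ (forall s C, prime_chain J s C -> (s <= r)%N).

End RingNotions.

Definition infinite_field (k : fieldType) : Prop :=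
  ~ exists s : seq k, forall x : k, x \in s.

Definition perfect_field (k : fieldType) : Prop :=
  forall p : nat, p \in [pchar k] -> forall x : k, exists y : k, y ^+ p = x.

Section Graded.
Variables (k : fieldType) (n : nat).
Local Notation S := {mpoly k[n.+1]}.
Implicit Types (I P : S -> Prop) (F f g : S).

Definition tdeg f : nat := (msize f).-1.

Definition homog_poly f : Prop := f \is homog mdeg.

Definition homog_ideal I : Prop :=
  is_ideal I /\ forall f d, I f -> I (pihomog mdeg d f).

(* dimension of a homogeneous ideal = dimension of its projective variety,
   i.e. (Krull dimension of S/I) - 1; here d >= 0. *)
Definition proj_dim I (d : nat) : Prop := krull_dim_quot I d.+1.

Definition unmixed I : Prop :=
  forall P Q a b, assoc_prime I P -> assoc_prime I Q ->
    krull_dim_quot P a -> krull_dim_quot Q b -> a = b.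

Definition indep_mod_deg I (m : nat) (gs : seq S) : Prop :=
  (forall g, g \in gs -> g \is m.-homog) /\
  forall c : 'I_(size gs) -> k,
    I (\sum_(i < size gs) c i *: gs`_i) -> forall i, c i = 0.

Definition hilbert_fun I (m r : nat) : Prop :=
  (exists gs, size gs = r /\ indep_mod_deg I m gs) /\
  (forall gs, indep_mod_deg I m gs -> (size gs <= r)%N).

Definition hilbert_poly I (Pl : {poly rat}) : Prop :=
  exists m0, forall m, (m0 <= m)%N ->
    exists r, hilbert_fun I m r /\ Pl.[m%:R] = r%:R.

Definition ideal_degree I (d e : nat) : Prop :=
  exists Pl, [/\ hilbert_poly I Pl, size Pl = d.+1 & (e%:R : rat) = (d`!)%:R * Pl`_d].

End Graded.

(* Main.v *)
Require Import Defs.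
From HB Require Import structures.
From mathcomp Require Import all_boot all_order all_algebra.
From mathcomp Require Import mpoly zify ring.
From Stdlib Require Import Classical ClassicalEpsilon.
Set Implicit Arguments. Unset Strict Implicit. Unset Printing Implicit Defensive.
Import Order.TTheory GRing.Theory Num.Theory.
Local Open Scope ring_scope.

(* Let S = k[x_0, ..., x_n].  It suffices to find r <= deg I such that every prime
   P containing F and the degree-r part I_r has dim S/P <= d: generic elements of
   I_r then cut the dimension one by one after F, and by Cohen-Macaulayness of S
   the sequence is regular.

   Choose a linear Noether normalization A = k[y_0, ..., y_d] of S/I.  As I is
   unmixed, S/I is torsion-free over A; let r be its rank, so r <= deg I by the
   leading term of the Hilbert polynomial.  The characteristic polynomial of a
   linear form l acting on S/I has its coefficients in A, because A is completely
   integrally closed, and evaluated at l it gives a form f_l in I_r, monic in l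
   (the cone over the projection of the variety along l).  If P is a prime with
   dim S/P > d containing all the f_l, then over the field Frac(S/P) all
   combinations over k of the commuting matrices (x_t - action of x_t on S/I) are
   singular, so these matrices have a common kernel vector, and I is contained
   in P; since F is a non-zero-divisor modulo I, P cannot contain F. *)

(** * Ideals of a commutative ring *)

(** All the forms are taken in one degree [r <= deg I], which gives both degree bounds at once when
    [deg F >= 1]. A single degree makes the candidates [I_r] a vector space, in which an infinite
    field allows finitely many primes to be avoided.

    Dimension is measured by growth of Gelfand-Kirillov type: chains of primes bound it from below,
    spanning families bound it from above, and a non-zero-divisor lying in a larger ideal costs one.
    Krull dimension, Hilbert polynomial and finiteness over [A] are thus compared by counting.

    The obstacle is that [S/I] is torsion-free over [A] but not free in general, so [x_t] acts by a
    matrix over [A] only after multiplication by a denominator [a]. Hence the pencil [a T - C] in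
    place of [T - C], and hence the division of its determinant by [a^r], for which one [c] must
    bound the denominators of all powers. It also explains why primes [P] with [dim S/P > d] are
    tractable: by finiteness over [A] such a [P] cannot contain [a], so [a] is invertible in
    [Frac(S/P)]. *)

Lemma fun_choice (A B : Type) (R : A -> B -> Prop) :
  (forall x, exists y, R x y) -> exists f, forall x, R x (f x).
Proof.
move=> H; exists (fun x => proj1_sig (constructive_indefinite_description _ (H x))).
by move=> x; apply: proj2_sig.
Qed.

Section Ideals.
Variable R : comRingType.
Implicit Types (I J P Q : R -> Prop) (f g h : R) (s : seq R).

Lemma ideal0 I : is_ideal I -> I 0. Proof. by case. Qed.
Lemma idealD I f g : is_ideal I -> I f -> I g -> I (f + g).
Proof. by case=> _ H _; apply: H. Qed.
Lemma ideal_mull I r f : is_ideal I -> I f -> I (r * f).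
Proof. by case=> _ _ H; apply: H. Qed.
Lemma ideal_mulr I r f : is_ideal I -> I f -> I (f * r).
Proof. by move=> H If; rewrite mulrC; apply: ideal_mull. Qed.
Lemma idealN I f : is_ideal I -> I f -> I (- f).
Proof. by move=> H If; rewrite -mulN1r; apply: ideal_mull. Qed.
Lemma idealB I f g : is_ideal I -> I f -> I g -> I (f - g).
Proof. by move=> H If Ig; apply: idealD => //; apply: idealN. Qed.
Lemma idealDr I f g : is_ideal I -> I f -> I (f + g) -> I g.
Proof. by move=> H If /(idealB H)/(_ If); rewrite addrAC subrr add0r. Qed.
Lemma ideal_sum I (T : Type) (r : seq T) (C : pred T) (F : T -> R) :
  is_ideal I -> (forall t, C t -> I (F t)) -> I (\sum_(t <- r | C t) F t).
Proof. by move=> H HF; elim/big_ind: _ => // [|x y]; [apply: ideal0 | apply: idealD]. Qed.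
Lemma idealX I f m : is_ideal I -> I f -> (0 < m)%N -> I (f ^+ m).
Proof. by move=> H If; case: m => // m _; rewrite exprS; apply: ideal_mulr. Qed.

Lemma primeX P f m : is_prime P -> P (f ^+ m) -> P f.
Proof.
case=> HP P1 PM; elim: m => [|m IH]; first by rewrite expr0.
by rewrite exprS => /PM [].
Qed.

Lemma prime_nzd P f : is_prime P -> ~ P f -> nzd_mod P f.
Proof. by case=> _ _ PM Pf g /PM []. Qed.

Definition ideal_add J f : R -> Prop := fun p => exists q r, J q /\ p = q + r * f.

Lemma ideal_addP J f : is_ideal J -> is_ideal (ideal_add J f).
Proof.
move=> HJ; split.
- by exists 0, 0; rewrite mul0r addr0; split=> //; apply: ideal0.
- move=> _ _ [q [r [Jq ->]]] [q' [r' [Jq' ->]]]; exists (q + q'), (r + r').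
  by split; [apply: idealD | rewrite mulrDl addrACA].
- move=> c _ [q [r [Jq ->]]]; exists (c * q), (c * r).
  by split; [apply: ideal_mull | rewrite mulrDr mulrA].
Qed.

Lemma ideal_add_sub J f : subideal J (ideal_add J f).
Proof. by move=> p Jp; exists p, 0; rewrite mul0r addr0. Qed.

Lemma ideal_add_mem J f : is_ideal J -> ideal_add J f f.
Proof. by move=> HJ; exists 0, 1; rewrite mul1r add0r; split=> //; apply: ideal0. Qed.

Lemma ideal_add_min J f I : is_ideal I -> subideal J I -> I f -> subideal (ideal_add J f) I.
Proof.
by move=> HI JI If _ [q [r [Jq ->]]]; apply: idealD; [|apply: JI|apply: ideal_mull].
Qed.

Lemma gen_nil p : gen_ideal (R := R) [::] p <-> p = 0.
Proof.
split=> [[a ->]|->]; first by rewrite big_ord0.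
by exists (fun=> 0); rewrite big_ord0.
Qed.

Lemma gen_cons f s p : gen_ideal (f :: s) p <-> ideal_add (gen_ideal s) f p.
Proof.
split=> [[a ->]|[q [r [[a ->] ->]]]].
  rewrite big_ord_recl /= addrC; exists (\sum_(i < size s) a (lift ord0 i) * s`_i), (a ord0).
  by split=> //; exists (fun i => a (lift ord0 i)).
exists (fun i => if unlift ord0 i is Some j then a j else r).
rewrite big_ord_recl /= unlift_none addrC; congr (_ + _).
by apply: eq_bigr => i _; rewrite liftK.
Qed.

Lemma gen_is_ideal s : is_ideal (gen_ideal s).
Proof.
elim: s => [|f s IH].
  by split=> [|f g /gen_nil-> /gen_nil->|r f /gen_nil->]; apply/gen_nil;
     rewrite ?addr0 ?mulr0.
case: (ideal_addP f IH) => H0 HD HM; split.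
- exact/gen_cons.
- by move=> p q /gen_cons Hp /gen_cons Hq; apply/gen_cons/HD.
- by move=> r p /gen_cons Hp; apply/gen_cons/HM.
Qed.

Lemma gen_min s J : is_ideal J -> (forall f, f \in s -> J f) -> subideal (gen_ideal s) J.
Proof.
move=> HJ; elim: s => [|f s IH] Hs p.
  by move/gen_nil=> ->; apply: ideal0.
move/gen_cons; apply: ideal_add_min => //; last by apply: Hs; rewrite mem_head.
by apply: IH => g gs; apply: Hs; rewrite inE gs orbT.
Qed.

Lemma gen_mem s f : f \in s -> gen_ideal s f.
Proof.
elim: s => // g s IH; rewrite inE => /orP[/eqP->|/IH H]; apply/gen_cons.
  by apply: ideal_add_mem; apply: gen_is_ideal.
exact: ideal_add_sub.
Qed.

Lemma gen_sub s s' : {subset s <= s'} -> subideal (gen_ideal s) (gen_ideal s').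
Proof. by move=> H; apply: gen_min; [apply: gen_is_ideal | move=> f /H; apply: gen_mem]. Qed.

Lemma gen_rcons f s p : gen_ideal (rcons s f) p <-> ideal_add (gen_ideal s) f p.
Proof.
rewrite -gen_cons; split; apply: gen_sub => x; by rewrite mem_rcons.
Qed.

Definition fin_gen I := exists s, forall p, I p <-> gen_ideal s p.
Definition noetherian := forall I, is_ideal I -> fin_gen I.

(** Otherwise choice builds a strictly increasing chain of counterexamples; its union is finitely
    generated, and the generators already lie in one member. *)
Lemma noetherian_ind (Phi : (R -> Prop) -> Prop) :
  noetherian ->
  (forall J, is_ideal J ->
    (forall J', is_ideal J' -> subideal J J' -> ~ subideal J' J -> Phi J') -> Phi J) ->
  forall J, is_ideal J -> Phi J.
Proof.
move=> HN Hind J0 HJ0; apply: NNPP => nPhi0.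
pose T := {J : R -> Prop | is_ideal J /\ ~ Phi J}.
have step (J : T) : exists J' : T,
    subideal (proj1_sig J) (proj1_sig J') /\ ~ subideal (proj1_sig J') (proj1_sig J).
  case: J => J [HJ nJ] /=; apply: NNPP => H; apply: nJ; apply: Hind => // J' HJ' JJ' J'J.
  by apply: NNPP => nPhi; apply: H; exists (exist _ J' (conj HJ' nPhi)).
have [nx Hnx] := fun_choice step.
pose C i : T := iter i nx (exist _ J0 (conj HJ0 nPhi0)).
have Cmon i j : (i <= j)%N -> subideal (proj1_sig (C i)) (proj1_sig (C j)).
  elim: j => [|j IH]; first by rewrite leqn0 => /eqP->.
  rewrite leq_eqVlt ltnS => /orP[/eqP-> //|/IH H p /H Hp].
  by have [H1 _] := Hnx (C j); apply: H1.
pose U p := exists i, proj1_sig (C i) p.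
have Cid i : is_ideal (proj1_sig (C i)) by case: (C i) => J [].
have HU : is_ideal U.
  split; first by exists 0%N; apply: ideal0 (Cid _).
  - move=> f g [i Hi] [j Hj]; exists (maxn i j); apply: idealD => //.
      by apply: Cmon Hi; apply: leq_maxl.
    by apply: Cmon Hj; apply: leq_maxr.
  - by move=> r f [i Hi]; exists i; apply: ideal_mull.
have [s Hs] := HN _ HU.
have [N HNs] : exists N, forall f, f \in s -> proj1_sig (C N) f.
  have : forall f, f \in s -> U f by move=> f /gen_mem/Hs.
  elim: s {Hs} => [|f s IH] Hs; first by exists 0%N.
  have [i Hi] := Hs f (mem_head _ _).
  have [|N HN'] := IH; first by move=> g gs; apply: Hs; rewrite inE gs orbT.
  exists (maxn i N) => g; rewrite inE => /orP[/eqP->|/HN' Hg].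
    by apply: Cmon Hi; apply: leq_maxl.
  by apply: Cmon Hg; apply: leq_maxr.
have [_ []] := Hnx (C N) => p Hp.
have /Hs : U p by exists N.+1.
exact: gen_min.
Qed.

Lemma noetherian_max (Phi : (R -> Prop) -> Prop) J0 :
  noetherian -> is_ideal J0 -> Phi J0 ->
  exists J, [/\ is_ideal J, Phi J &
    forall J', is_ideal J' -> Phi J' -> subideal J J' -> subideal J' J].
Proof.
move=> HN HJ0 H0; apply: NNPP => H.
suff : ~ Phi J0 by [].
move: J0 HJ0 {H0}; apply: noetherian_ind => // J HJ IH PJ.
apply: H; exists J; split=> // J' HJ' PJ' JJ'; apply: NNPP => nJ'J.
exact: IH nJ'J PJ'.
Qed.

Definition prod_in (Ps : seq (R -> Prop)) (J : R -> Prop) :=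
  forall f : nat -> R, (forall i, (i < size Ps)%N -> nth (fun=> True) Ps i (f i)) ->
    J (\prod_(i < size Ps) f i).

(** If [a * b] is in [J] but neither factor is, then [(J + a)(J + b)] lies in [J], so the two lists
    concatenate. With [prime_prod_in] this stands in for the finiteness of the set of minimal primes
    over [J]. *)
Lemma prime_product_below J : noetherian -> is_ideal J ->
  exists Ps : seq (R -> Prop),
    (forall i, (i < size Ps)%N -> is_prime (nth (fun=> True) Ps i) /\
        subideal J (nth (fun=> True) Ps i)) /\ prod_in Ps J.
Proof.
move=> HN; move: J; apply: noetherian_ind => // J HJ IH.
have [J1|nJ1] := classic (J 1).
  by exists [::]; split=> // f _; rewrite big_ord0.
have [HP|nP] := classic (is_prime J).
  exists [:: J]; split=> [[_|i] |f Hf]; [by split | by rewrite ltnS ltn0 |].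
  by rewrite /= big_ord_recl big_ord0 mulr1; apply: (Hf 0%N).
have [a [b [Jab na nb]]] : exists a b, [/\ J (a * b), ~ J a & ~ J b].
  apply: NNPP => H; apply: nP; split=> // f g Jfg; apply: NNPP => nfg; apply: H.
  by exists f, g; split=> //; tauto.
have Hadd c : ~ J c -> exists Ps : seq (R -> Prop),
    (forall i, (i < size Ps)%N -> is_prime (nth (fun=> True) Ps i) /\
        subideal J (nth (fun=> True) Ps i)) /\ prod_in Ps (ideal_add J c).
  move=> nc; have [||Ps [H1 H2]] := IH (ideal_add J c) (ideal_addP c HJ).
  - exact: ideal_add_sub.
  - by move/(_ c (ideal_add_mem c HJ)).
  exists Ps; split=> // i /H1 [Hp Hs]; split=> // p Jp; apply: Hs; exact: ideal_add_sub.
have [Ps [P1 P2]] := Hadd a na; have [Qs [Q1 Q2]] := Hadd b nb.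
exists (Ps ++ Qs); split=> [i|f Hf].
  rewrite size_cat nth_cat; case: (ltnP i (size Ps)) => [lt_i _|le_i Hi]; first exact: P1.
  by apply: Q1; rewrite ltn_subLR.
rewrite size_cat big_split_ord /=.
have [|x [r [Jx ->]]] := P2 f.
  by move=> i Hi; have := Hf i; rewrite size_cat nth_cat Hi; apply; apply: ltn_addr.
have [|y [t [Jy ->]]] := Q2 (fun i => f (size Ps + i)%N).
  move=> i Hi; have := Hf (size Ps + i)%N.
  by rewrite size_cat nth_cat ltn_add2l [(_ + i < _)%N]ltnNge leq_addr /= addKn; apply.
rewrite mulrDl; apply: idealD => //; first exact: ideal_mulr.
rewrite mulrDr; apply: idealD => //; first exact: ideal_mull.
by rewrite mulrACA; apply: ideal_mull.
Qed.

Lemma prime_prod_in Ps J P : is_prime P -> subideal J P -> prod_in Ps J ->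
  exists2 i, (i < size Ps)%N & subideal (nth (fun=> True) Ps i) P.
Proof.
move=> HP JP HPs; apply: NNPP => H.
have [f Hf] : exists f : nat -> R, forall i, (i < size Ps)%N ->
    nth (fun=> True) Ps i (f i) /\ ~ P (f i).
  apply: (@fun_choice nat R (fun i x => (i < size Ps)%N ->
    nth (fun=> True) Ps i x /\ ~ P x)) => i.
  case: ltnP => [Hi|_]; last by exists 0.
  apply: NNPP => H'; apply: H; exists i => // x Hx; apply: NNPP => nx.
  by apply: H'; exists x.
have : P (\prod_(i < size Ps) f i) by apply/JP/HPs => i /Hf [].
case: HP => HP P1 PM.
elim/big_ind: _ => // [x y Hx Hy /PM [] //|i _]; by case: (Hf i (ltn_ord i)).
Qed.

(* Localising at C: an annihilator (I : g) maximal among those inside a prime C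
   is itself prime. *)
Lemma assoc_prime_below I C : noetherian -> is_ideal I -> is_prime C ->
  subideal I C -> exists P, assoc_prime I P /\ subideal P C.
Proof.
move=> HN HI HC IC.
pose ann g := fun f => I (f * g).
have Hann g : is_ideal (ann g).
  split; rewrite /ann; first by rewrite mul0r; apply: ideal0.
  - by move=> f f' H H'; rewrite mulrDl; apply: idealD.
  - by move=> r f H; rewrite -mulrA; apply: ideal_mull.
pose Phi J := subideal J C /\ exists g, J = ann g.
have [|J [HJ [JC [g Jg]] Jmax]] := @noetherian_max Phi (ann 1) HN (Hann 1).
  by split; [move=> f; rewrite /ann mulr1; apply: IC | exists 1].
case: (HC) => _ C1 CM.
have key (s : R) : ~ C s -> subideal (ann (s * g)) J.
  move=> nCs; apply: Jmax => //.
    split; last by exists (s * g).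
    move=> f; rewrite /ann mulrA => H; have /JC /CM [] // : J (f * s).
    by rewrite Jg.
  by move=> f; rewrite Jg /ann => H; rewrite mulrCA; apply: ideal_mull.
exists J; split=> //; split; last by exists g => f; rewrite Jg.
split=> //; first by move/JC.
move=> a b Jab; apply: NNPP => nab.
have [na nb] : ~ J a /\ ~ J b by tauto.
have nC : ~ subideal (ann (a * g)) C.
  move=> H; have /Jmax HM : Phi (ann (a * g)) by split=> //; exists (a * g).
  apply: nb; apply: HM => //.
    by move=> f; rewrite Jg /ann => Hf; rewrite mulrCA; apply: ideal_mull.
  by move: Jab; rewrite Jg /ann mulrA (mulrC b).
apply: nC => s Hs; apply: NNPP => nCs; apply: na.
by apply: (key s nCs); move: Hs; rewrite /ann !mulrA (mulrC s).
Qed.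

(** An annihilator [(I : h)], with [h] outside [I], that is maximal among those containing [a] is
    prime. *)
Lemma assoc_prime_ann I g a : noetherian -> is_ideal I -> ~ I g -> I (a * g) ->
  exists P, assoc_prime I P /\ P a.
Proof.
move=> HN HI ng Iag.
pose ann g := fun f => I (f * g).
have Hann h : is_ideal (ann h).
  split; rewrite /ann; first by rewrite mul0r; apply: ideal0.
  - by move=> f f' H H'; rewrite mulrDl; apply: idealD.
  - by move=> r f H; rewrite -mulrA; apply: ideal_mull.
pose Phi J := J a /\ exists h, J = ann h /\ ~ I h.
have [|J [HJ [Ja [h [Jh nh]]] Jmax]] := @noetherian_max Phi (ann g) HN (Hann g).
  by split=> //; exists g.
exists J; split=> //; split; last by exists h => f; rewrite Jh.
split=> //; first by rewrite Jh /ann mul1r.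
move=> x y Jxy; apply: NNPP => nxy.
have [nx ny] : ~ J x /\ ~ J y by tauto.
apply: nx; have /Jmax HM : Phi (ann (y * h)).
  split; first by rewrite /ann mulrCA; apply: ideal_mull => //; rewrite Jh in Ja.
  by exists (y * h); split=> //; move: ny; rewrite Jh.
apply: HM => //; first by move=> f; rewrite Jh /ann => Hf; rewrite mulrCA; apply: ideal_mull.
by move: Jxy; rewrite Jh /ann mulrA.
Qed.

End Ideals.

(** * Noetherianity of polynomial rings *)

Section HilbertBasis.
Variable R : comRingType.
Hypothesis HR : noetherian R.

Let lcoef (J : {poly R} -> Prop) i : R -> Prop :=
  fun a => exists p, [/\ J p, (size p <= i.+1)%N & p`_i = a].

Let lcoef_ideal J i : is_ideal J -> is_ideal (lcoef J i).
Proof.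
move=> HJ; split.
- by exists 0; rewrite size_poly0 coef0; split=> //; apply: ideal0.
- move=> _ _ [p [Jp sp <-]] [q [Jq sq <-]]; exists (p + q); rewrite coefD; split=> //.
    exact: idealD.
  by apply: leq_trans (size_polyD _ _) _; rewrite geq_max sp.
- move=> r _ [p [Jp sp <-]]; exists (r%:P * p); rewrite coefCM; split=> //.
    exact: ideal_mull.
  by rewrite mul_polyC; apply: leq_trans (size_scale_leq _ _) _.
Qed.

Let lcoef_mono J i j a : is_ideal J -> (i <= j)%N -> lcoef J i a -> lcoef J j a.
Proof.
move=> HJ le_ij [p [Jp sp <-]]; exists ('X^(j - i) * p); split.
- exact: ideal_mull.
- apply: leq_trans (size_polyMleq _ _) _; rewrite size_polyXn /=.
  by apply: leq_trans (leq_add (leqnn _) sp) _; rewrite addnS subnK.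
- by rewrite coefXnM ltnNge leq_subr /= subKn.
Qed.

Let lift_gens J i (s : seq R) : is_ideal J -> (forall a, a \in s -> lcoef J i a) ->
  exists G : seq {poly R}, (forall p, p \in G -> J p) /\
   forall a, gen_ideal s a -> lcoef (gen_ideal G) i a.
Proof.
move=> HJ; elim: s => [|b s IH] Hs.
  exists [::]; split=> // a /gen_nil ->; exact: ideal0 (lcoef_ideal _ (gen_is_ideal _)).
have [|G [GJ HG]] := IH; first by move=> a As; apply: Hs; rewrite inE As orbT.
have [q [Jq sq qb]] := Hs b (mem_head _ _).
exists (q :: G); split=> [p|a /gen_cons [c [r [/HG [p [Gp sp <-]] ->]]]].
  by rewrite inE => /orP[/eqP->|/GJ].
exists (p + r%:P * q); rewrite coefD coefCM qb; split=> //.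
  by apply/gen_cons; exists p, r%:P.
apply: leq_trans (size_polyD _ _) _; rewrite geq_max sp mul_polyC.
by apply: leq_trans (size_scale_leq _ _) _.
Qed.

Lemma noetherian_poly : noetherian {poly R}.
Proof.
move=> J HJ.
have HL : is_ideal (fun a => exists i, lcoef J i a).
  split; first by exists 0%N; apply: ideal0 (lcoef_ideal _ HJ).
  - move=> a b [i Hi] [j Hj]; exists (maxn i j); apply: idealD (lcoef_ideal _ HJ) _ _.
      by apply: lcoef_mono Hi; rewrite ?leq_maxl.
    by apply: lcoef_mono Hj; rewrite ?leq_maxr.
  - by move=> r a [i Hi]; exists i; apply: ideal_mull (lcoef_ideal _ HJ) _.
have [s Hs] := HR HL.
(* All generators of the ideal of leading coefficients occur in degree [D]. From [D] on one list
   [G'] suffices; below [D] there are finitely many degrees, treated by [low]. *)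
have [D HD] : exists D, forall a, a \in s -> lcoef J D a.
  have : forall a, a \in s -> exists i, lcoef J i a by move=> a /gen_mem/Hs.
  elim: s {Hs} => [|a s IH] Hs; first by exists 0%N.
  have [|D HD] := IH; first by move=> b bs; apply: Hs; rewrite inE bs orbT.
  have [i Hi] := Hs a (mem_head _ _).
  exists (maxn i D) => b; rewrite inE => /orP[/eqP->|/HD H].
    by apply: lcoef_mono Hi; rewrite ?leq_maxl.
  by apply: lcoef_mono H; rewrite ?leq_maxr.
have low m : exists G : seq {poly R}, (forall p, p \in G -> J p) /\
    forall i, (i < m)%N -> forall a, lcoef J i a -> lcoef (gen_ideal G) i a.
  elim: m => [|m [G [GJ HG]]]; first by exists [::].
  have [t Ht] := HR (lcoef_ideal m HJ).
  have [|G' [GJ' HG']] := lift_gens (i := m) (s := t) HJ.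
    by move=> a /gen_mem/Ht.
  exists (G ++ G'); split=> [p|i]; first by rewrite mem_cat => /orP[/GJ|/GJ'].
  rewrite ltnS leq_eqVlt => /orP[/eqP->|lt_im] a.
    move/Ht/HG' => [p [Gp sp pa]]; exists p; split=> //.
    by apply: gen_sub Gp => x; rewrite mem_cat orbC => ->.
  move/(HG _ lt_im) => [p [Gp sp pa]]; exists p; split=> //.
  by apply: gen_sub Gp => x; rewrite mem_cat => ->.
have [G [GJ HG]] := low D.
have [G' [GJ' HG']] := lift_gens HJ HD.
have all_i i a : lcoef J i a -> lcoef (gen_ideal (G ++ G')) i a.
  case: (ltnP i D) => [lt_iD|le_Di] Hia.
    have [p [Gp sp pa]] := HG _ lt_iD _ Hia; exists p; split=> //.
    by apply: gen_sub Gp => x; rewrite mem_cat => ->.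
  have /Hs/HG' H : exists i, lcoef J i a by exists i.
  apply: lcoef_mono le_Di _; first exact: gen_is_ideal.
  have [p [Gp sp pa]] := H; exists p; split=> //.
  by apply: gen_sub Gp => x; rewrite mem_cat orbC => ->.
exists (G ++ G') => p; split; last first.
  by apply: gen_min => // f; rewrite mem_cat => /orP[/GJ|/GJ'].
have [m] := ubnP (size p); elim: m p => // m IH p; rewrite ltnS => sp Jp.
case: m sp IH => [|m] sp IH.
  move: sp; rewrite leqn0 size_poly_eq0 => /eqP->; exact: ideal0 (gen_is_ideal _).
have [q [Gq sq qa]] : lcoef (gen_ideal (G ++ G')) m p`_m by apply: all_i; exists p.
rewrite -(subrK q p); apply: (idealD _ _ Gq); first exact: gen_is_ideal.
apply: IH; last first.
  by apply: idealB => //; apply: gen_min Gq => // f; rewrite mem_cat => /orP[/GJ|/GJ'].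
rewrite ltnS; apply/leq_sizeP => j; rewrite leq_eqVlt coefB => /orP[/eqP<-|lt_mj].
  by rewrite qa subrr.
by rewrite !nth_default ?subrr // (leq_trans _ lt_mj).
Qed.

End HilbertBasis.

Lemma noetherian_surj (R R' : comRingType) (phi : {rmorphism R -> R'}) :
  (forall y, exists x, phi x = y) -> noetherian R -> noetherian R'.
Proof.
move=> surj HR I HI.
have HJ : is_ideal (fun x => I (phi x)).
  split; rewrite ?rmorph0; first exact: ideal0.
  - by move=> f g; rewrite rmorphD; apply: idealD.
  - by move=> r f; rewrite rmorphM; apply: ideal_mull.
have [s Hs] := HR _ HJ.
exists (map phi s) => y; split; last first.
  by apply: gen_min => // f /mapP [x /gen_mem/Hs Ix ->].
have [x <-] := surj y => /Hs [a ->].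
rewrite rmorph_sum; apply: ideal_sum (gen_is_ideal _) _ => i _; rewrite rmorphM.
apply: ideal_mull (gen_is_ideal _) _; apply: gen_mem; apply: map_f; exact: mem_nth.
Qed.

Section MpolyPoly.
Variable k : fieldType.

(** Left inverse of [muni]; it carries noetherianity and complete integral closedness from
    [{poly _}] to [{mpoly _}]. *)
Definition of_uni n : {poly {mpoly k[n]}} -> {mpoly k[n.+1]} :=
  horner_eval ('X_ord_max : {mpoly k[n.+1]}) \o map_poly (@mwiden n k).
HB.instance Definition _ n := GRing.RMorphism.on (@of_uni n).

Lemma of_uniC n p : @of_uni n p%:P = mwiden p.
Proof. by rewrite /of_uni /= map_polyC /horner_eval hornerC. Qed.

Lemma of_uniX n : @of_uni n 'X = 'X_ord_max.
Proof. by rewrite /of_uni /= map_polyX /horner_eval hornerX. Qed.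

Lemma muniK n : cancel (@muni n k) (@of_uni n).
Proof.
move=> p; rewrite muniE [RHS]mpolyE rmorph_sum; apply: eq_bigr => m _.
rewrite -!mul_polyC !rmorphM rmorphXn /= of_uniX !of_uniC -?mul_mpolyC.
rewrite mwidenM mwidenC mwidenX -mulrA; congr (_ * _).
rewrite mpolyXn -mpolyXD; congr 'X_[_]; apply/mnmP => i.
rewrite mnmDE mulmnE mnm1E; case: (unliftP ord_max i) => [j ->|->]; last first.
  by rewrite mnmwiden_ordmax eqxx mul1n.
have -> : lift ord_max j = widen_ord (leqnSn n) j by apply: val_inj; rewrite /= /bump leqNgt ltn_ord.
rewrite mnmwiden_widen mnmE; case: eqP => [/(congr1 val) /= E|_]; last by rewrite addn0.
by move: (ltn_ord j); rewrite -E ltnn.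
Qed.

Lemma mpoly0C (p : {mpoly k[0]}) : p = (p@_0)%:MP.
Proof.
apply/mpolyP => m; rewrite mcoeffC; have -> : m = 0%MM by apply/mnmP => -[].
by rewrite eqxx mulr1.
Qed.

End MpolyPoly.

Lemma noetherian_mpoly (k : fieldType) n : noetherian {mpoly k[n]}.
Proof.
elim: n => [|n IH]; last first.
  apply: (@noetherian_surj {poly {mpoly k[n]}} {mpoly k[n.+1]} (@of_uni k n)); last exact: noetherian_poly.
  by move=> p; exists (muni p); apply: muniK.
move=> I HI; have [H|H] := classic (exists p, I p /\ p != 0); last first.
  exists [::] => p; split=> [Ip|/gen_nil->]; last exact: ideal0.
  by apply/gen_nil; apply: NNPP => /eqP np; apply: H; exists p.
have [p [Ip np]] := H; exists [:: 1] => q; split=> _.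
  by apply/gen_cons; exists 0, q; rewrite add0r mulr1; split=> //; apply: ideal0 (gen_is_ideal _).
rewrite (mpoly0C p) in Ip np.
have <- : (q@_0 / (p@_0)) %:MP * (p@_0)%:MP = q; last exact: ideal_mull.
rewrite -mpolyCM divfK -?mpoly0C //; by apply: contra_neq np => ->; rewrite mpolyC0.
Qed.

(** * Complete integral closedness of polynomial rings *)

(* Complete integral closedness, phrased inside the domain: if b/a has all its
   powers in c^-1 R, then b/a lies in R. *)
Definition cic (R : idomainType) := forall a b c : R, a != 0 -> c != 0 ->
  (forall j, exists q, c * b ^+ j = a ^+ j * q) -> exists q, b = a * q.

Section Cic.
Import Pdiv.Idomain.
Variable R : idomainType.

(** Here [%|] is pseudo-divisibility, that is, divisibility over the fraction field. With [a1], [b1]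
    the coprime cofactors of the gcd, [a1 ^+ j] divides [c] for every [j], which by degrees makes
    [a1] constant. *)
Lemma bounded_powers_dvdp (a b c : {poly R}) : a != 0 -> c != 0 ->
  (forall j, a ^+ j %| c * b ^+ j) -> a %| b.
Proof.
move=> a0 c0 Hj; pose g := gcdp a b.
have g0 : g != 0 by rewrite gcdp_eq0 negb_and a0.
have lg k : lead_coef g ^+ k != 0 by rewrite expf_neq0 // lead_coef_eq0.
have Ea := dvdp_gcdl a b; have Eb := dvdp_gcdr a b.
rewrite dvdp_eq in Ea; rewrite dvdp_eq in Eb.
move/eqP: Ea => Ea; move/eqP: Eb => Eb.
rewrite -/g in Ea Eb.
set a1 := a %/ g in Ea; set b1 := b %/ g in Eb.
have cop : coprimep a1 b1 by apply: coprimep_div_gcd; rewrite a0.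
have H j : a1 ^+ j %| c.
  rewrite -(Gauss_dvdpl c (coprimep_expl j (coprimep_expr j cop))).
  rewrite -(dvdp_mul2r _ _ (expf_neq0 j g0)) -mulrA -!exprMn -Ea -Eb !exprZn -scalerAr.
  by rewrite dvdpZl ?(expf_neq0 _ (lg _)) // dvdpZr ?(expf_neq0 _ (lg _)).
have : (size a1 <= 1)%N.
  rewrite leqNgt; apply/negP => s1; have := dvdp_leq c0 (H (size c)).
  have := size_exp a1 (size c); have : (0 < size c)%N by rewrite size_poly_gt0.
  move: s1; case: (size a1) => [|[|m]] //= _; rewrite mulSn => Hc Hs Hl.
  have : (size c <= (size (a1 ^+ size c)).-1)%N by rewrite Hs leq_addr.
  by move: Hc Hl; case: (size (a1 ^+ _)) => [|e] /=; [lia | move=> _ Hl /(leq_trans Hl); rewrite ltnn].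
move=> s1; have : a %| g.
  rewrite -(dvdpZl _ _ (lg (scalp a g))) Ea.
  have a10 : a1 != 0.
    apply: contraNneq a0 => E; move: Ea; rewrite E mul0r => /eqP.
    by rewrite -mul_polyC mulf_eq0 polyC_eq0 (negbTE (lg _)).
  have -> : a1 = (a1`_0)%:P by apply: size1_polyC.
  rewrite mul_polyC dvdpZl ?dvdpp //.
  by apply: contra_neq a10 => E; rewrite (size1_polyC s1) E.
by move=> ag; apply: dvdp_trans ag (dvdp_gcdr a b).
Qed.

(** The leading coefficients satisfy the hypothesis of [cic R], so [s] divides that of [z];
    subtracting the leading term lowers the size. *)
Lemma bounded_powers_scale (s : R) (c z : {poly R}) : cic R -> s != 0 -> c != 0 ->
  (forall j, exists q, c * z ^+ j = s ^+ j *: q) -> exists w, z = s *: w.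
Proof.
move=> HR s0 c0; have [m] := ubnP (size z); elim: m z => // m IH z.
rewrite ltnS => sz Hj; have [->|z0] := eqVneq z 0; first by exists 0; rewrite scaler0.
have [||l Hl] := HR s (lead_coef z) (lead_coef c) s0.
  by rewrite lead_coef_eq0.
  move=> j; have [q Hq] := Hj j; exists (lead_coef q).
  by rewrite -lead_coef_exp -lead_coefM Hq lead_coefZ.
pose t := 'X^((size z).-1) : {poly R}; pose z' := z - s *: (l *: t).
have [|j|w Hw] := IH z'.
- apply: leq_trans sz; rewrite [X in (_ < X)%N](polySpred z0) ltnS.
  apply/leq_sizeP => i; rewrite leq_eqVlt => /orP[/eqP<-|lt_i].
    by rewrite coefB !coefZ coefXn eqxx mulr1 -Hl subrr.
  rewrite coefB !coefZ coefXn nth_default; last by rewrite (polySpred z0).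
  by rewrite (gtn_eqF lt_i) !mulr0 subr0.
(* Mixed powers are needed for the induction on [j]: expanding one factor [z'] produces an extra
   factor [z]. *)
- suff : forall i, exists q, c * z ^+ i * z' ^+ j = s ^+ (i + j) *: q.
    by move/(_ 0%N); rewrite expr0 mulr1.
  elim: j => [|j IHj] i; first by rewrite expr0 mulr1 addn0.
  have [q1 Hq1] := IHj i.+1; have [q2 Hq2] := IHj i.
  exists (q1 - l *: t * q2).
  have -> : c * z ^+ i * z' ^+ j.+1 =
      c * z ^+ i.+1 * z' ^+ j - s *: (l *: t * (c * z ^+ i * z' ^+ j)).
    by rewrite [z' ^+ _]exprSr [z ^+ i.+1]exprSr {2}/z' -!mul_polyC; ring.
  rewrite Hq1 Hq2 addnS addSn scalerBr exprS -!scalerAr !scalerA; congr (_ - _).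
- by exists (w + l *: t); rewrite scalerDr -Hw subrK.
Qed.

(** Pseudo-division gives [s *: b = z * a] with [s] a power of the leading coefficient of [a]; then
    [z] has bounded powers over [s], which removes [s]. *)
Lemma cic_poly : cic R -> cic {poly R}.
Proof.
move=> HR a b c a0 c0 Hj.
have : a %| b.
  apply: (bounded_powers_dvdp a0 c0) => j; have [q ->] := Hj j; exact: dvdp_mulIl.
rewrite dvdp_eq => /eqP Eb.
set s := lead_coef a ^+ _ in Eb; set z := b %/ a in Eb.
have s0 : s != 0 by rewrite expf_neq0 // lead_coef_eq0.
have [|w Hw] := bounded_powers_scale (z := z) HR s0 c0.
  move=> j; have [q Hq] := Hj j; exists q; apply: (mulIf (expf_neq0 j a0)).
  by rewrite -mulrA -exprMn -Eb exprZn -scalerAr Hq -scalerAl mulrC.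
have sC0 : s%:P != 0 by rewrite polyC_eq0.
by exists w; apply: (mulfI sC0); rewrite !mul_polyC Eb Hw mulrC -scalerAr.
Qed.
End Cic.

Lemma cic_mpoly (k : fieldType) n : cic {mpoly k[n]}.
Proof.
elim: n => [|n IH] a b c a0 c0 Hj.
  rewrite (mpoly0C a) (mpoly0C b) in a0 *; exists (b@_0 / a@_0)%:MP.
  rewrite -mpolyCM mulrC divfK //; by apply: contra_neq a0 => ->; rewrite mpolyC0.
have inj0 (x : {mpoly k[n.+1]}) : x != 0 -> muni x != 0.
  by apply: contra_neq => E; rewrite -[x]muniK E rmorph0.
have [|q Hq] := cic_poly IH (inj0 a a0) (inj0 c c0) (b := muni b).
  move=> j; have [q Hq] := Hj j; exists (muni q); move: (congr1 (@muni n k) Hq).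
  by rewrite !muniM ?rmorphXn /=.
by exists (of_uni q); rewrite -[b]muniK Hq rmorphM /= muniK.
Qed.

(** * Dimension of primes through growth *)

Lemma exists_relation (F : fieldType) (T T' : finType) (M : T -> T' -> F) :
  (#|T'| < #|T|)%N ->
  exists c : T -> F, (exists t, c t != 0) /\ forall s, \sum_t c t * M t s = 0.
Proof.
move=> lt_T; pose A := \matrix_(i < #|T|, j < #|T'|) M (enum_val i) (enum_val j).
have nz : kermx A != 0.
  by rewrite kermx_eq0 /row_free neq_ltn (leq_ltn_trans (rank_leq_col A)).
pose v := nz_row (kermx A).
have v0 : v != 0 by rewrite nz_row_eq0.
have vA : v *m A = 0 by apply/sub_kermxP/nz_row_sub.
exists (fun t => v 0 (enum_rank t)); split.
  case/rV0Pn: v0 => i vi; exists (enum_val i); by rewrite enum_valK.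
move=> s; move/rowP/(_ (enum_rank s)): vA; rewrite !mxE => E.
rewrite -[RHS]E (reindex _ (onW_bij _ (enum_val_bij T))) /=.
by apply: eq_bigr => i _; rewrite enum_valK mxE enum_rankK.
Qed.

Section Growth.
Variables (k : fieldType) (N : nat).
Local Notation S := {mpoly k[N]}.
Implicit Types (I J P Q : S -> Prop) (f g h p q : S).

Lemma idealZ J (c : k) f : is_ideal J -> J f -> J (c *: f).
Proof. by move=> HJ Jf; rewrite -mul_mpolyC; apply: ideal_mull. Qed.

Definition degle m p := (msize p <= m.+1)%N.

Lemma degleW m m' p : (m <= m')%N -> degle m p -> degle m' p.
Proof. by move=> le_m H; apply: leq_trans H _. Qed.
Lemma degle0 m : degle m 0. Proof. by rewrite /degle msize0. Qed.
Lemma degle1 m : degle m 1. Proof. by rewrite /degle msize1. Qed.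
Lemma degleD m p q : degle m p -> degle m q -> degle m (p + q).
Proof. by move=> Hp Hq; apply: leq_trans (msizeD_le _ _) _; rewrite geq_max; apply/andP. Qed.
Lemma degleZ m c p : degle m p -> degle m (c *: p).
Proof. exact: leq_trans (msizeZ_le _ _). Qed.
Lemma degleM a b p q : degle a p -> degle b q -> degle (a + b) (p * q).
Proof.
rewrite /degle; have [->|p0] := eqVneq p 0; first by rewrite mul0r msize0.
have [->|q0] := eqVneq q 0; first by rewrite mulr0 msize0.
move=> Hp Hq; rewrite msizeM // -subn1 leq_subLR.
by apply: leq_trans (leq_add Hp Hq) _; rewrite add1n addnS addSn.
Qed.
Lemma degleX a p i : degle a p -> degle (i * a) (p ^+ i).
Proof.
move=> H; elim: i => [|i IH]; first by rewrite expr0 degle1.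
by rewrite exprS mulSn; apply: degleM.
Qed.
Lemma degle_sum m (T : Type) (r : seq T) (C : pred T) (F : T -> S) :
  (forall t, C t -> degle m (F t)) -> degle m (\sum_(t <- r | C t) F t).
Proof. by move=> H; elim/big_ind: _ => //; [apply: degle0 | apply: degleD]. Qed.
Lemma degle_homog m p : p \is m.-homog -> degle m p.
Proof.
move=> /dhomogP H; rewrite /degle msizeE; apply/bigmax_leqP_seq => i ip _.
by rewrite H.
Qed.
Lemma degle_tdeg p : degle (msize p) p. Proof. by rewrite /degle. Qed.

Definition lin_indep J (T : finType) (g : T -> S) :=
  forall c : T -> k, J (\sum_t c t *: g t) -> forall t, c t = 0.

Definition spanned J (U : S -> Prop) m := exists (T : finType) (e : T -> S),
  (#|T| <= m)%N /\ forall p, U p -> exists c : T -> k, J (p - \sum_t c t *: e t).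

Lemma indep_card J U (T : finType) (g : T -> S) m : is_ideal J ->
  lin_indep J g -> (forall t, U (g t)) -> spanned J U m -> (#|T| <= m)%N.
Proof.
move=> HJ Hg HU [T' [e [le_m He]]]; apply: leq_trans le_m.
have [M HM] := fun_choice (fun t => He _ (HU t)).
rewrite leqNgt; apply/negP => /(exists_relation M) [c [[t ct] Hc]].
move/eqP: ct; apply; apply: (Hg c).
have -> : \sum_t c t *: g t = \sum_t c t *: (g t - \sum_s M t s *: e s).
  have Z : \sum_t c t *: (\sum_s M t s *: e s) = 0.
    under eq_bigr => u _ do rewrite scaler_sumr.
    rewrite exchange_big big1 // => s _.
    by under eq_bigr => u _ do rewrite scalerA; rewrite -scaler_suml Hc scale0r.
  by under [RHS]eq_bigr => u _ do rewrite scalerBr; rewrite sumrB Z subr0.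
by apply: ideal_sum => // u _; apply: idealZ.
Qed.

(* Lower bound on the affine Hilbert function: [grows J r] says that S/J has
   Gelfand-Kirillov dimension at least [r]. *)
Definition grows J r := exists c : nat, forall M : nat,
  exists (T : finType) (g : T -> S),
    [/\ #|T| = (M ^ r)%N, forall t, degle (c * M) (g t) & lin_indep J g].

Lemma grows_sub J Q r : subideal J Q -> grows Q r -> grows J r.
Proof.
move=> JQ [c H]; exists c => M; have [T [g [H1 H2 H3]]] := H M.
by exists T, g; split=> // a /JQ/H3.
Qed.

Lemma grows0 J : is_ideal J -> ~ J 1 -> grows J 0.
Proof.
move=> HJ J1; exists 0%N => M; exists unit, (fun=> 1); split=> [|t|c].
- by rewrite card_unit.
- exact: degle1.
- rewrite (big_pred1 tt) => [|[]//] H [].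
  apply/eqP/negP => /negP c0; apply: J1.
  by have := idealZ (c tt)^-1 HJ H; rewrite scalerA mulVf // scale1r.
Qed.

(** For [g] independent modulo [Q], the products [h ^+ i * g t] with [i < M] are independent modulo
    [J]: modulo [Q] a relation reduces to its layer [i = 0], which must vanish, and then one [h]
    cancels. *)
Lemma grows_step J Q h r : is_ideal J -> is_ideal Q -> subideal J Q ->
  Q h -> nzd_mod J h -> grows Q r -> grows J r.+1.
Proof.
move=> HJ HQ JQ Qh Jh [c Hc]; exists (msize h + c)%N => M.
have [T [g [cT dg ig]]] := Hc M.
exists ('I_M * T)%type, (fun x : 'I_M * T => h ^+ x.1 * g x.2); split.
- by rewrite card_prod card_ord cT expnS.
- case=> i t /=; apply: degleW (degleM (degleX i (degle_tdeg h)) (dg t)).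
  by rewrite mulnDl leq_add2r mulnC leq_mul2l ltnW ?orbT.
move=> a Ha.
have key m (p : nat -> S) : (forall i, Q (p i) -> p i = 0) ->
    J (\sum_(i < m) h ^+ i * p i) -> forall i, (i < m)%N -> p i = 0.
  elim: m p => [//|m IH] p Hp; rewrite big_ord_recl expr0 mul1r => H.
  pose s := \sum_(i < m) h ^+ i * p i.+1.
  have E : \sum_(i < m) h ^+ lift ord0 i * p (lift ord0 i) = h * s.
    by rewrite mulr_sumr; apply: eq_bigr => i _; rewrite mulrA -exprS.
  rewrite E in H; have p0 : p 0%N = 0.
    by apply: Hp; apply: (@idealDr _ Q (h * s)); [by [] |  exact: ideal_mulr | by rewrite addrC; apply: JQ].
  case=> [//|i]; rewrite ltnS; apply: (IH (fun i => p i.+1)) => [j /Hp //|].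
  by apply: Jh; move: H; rewrite p0 add0r.
pose p i := \sum_t (if insub i is Some j then a (j, t) else 0) *: g t.
have pz i : Q (p i) -> forall t, (if insub i is Some j then a (j, t) else 0) = 0 :> k.
  exact: ig.
case=> i t; have := pz i; rewrite valK; apply.
have -> : p i = 0; last exact: ideal0.
apply: (key M p _ _ _ (ltn_ord i)).
  by move=> j /pz H; apply: big1 => u _; rewrite H scale0r.
move: Ha; congr J.
rewrite (eq_bigr (fun x => a (x.1, x.2) *: (h ^+ x.1 * g x.2))) => [|[] //].
rewrite -(pair_bigA _ (fun i t => a (i, t) *: (h ^+ i * g t))) /=.
apply: eq_bigr => j _; rewrite /p valK mulr_sumr; apply: eq_bigr => u _.
by rewrite scalerAr.
Qed.

Lemma grows_prime P Q r : is_prime P -> is_ideal Q -> subideal P Q ->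
  ~ subideal Q P -> grows Q r -> grows P r.+1.
Proof.
move=> HP HQ PQ nQP; have [h [Qh Ph]] : exists h, Q h /\ ~ P h.
  apply: NNPP => H; apply: nQP => h Qh; apply: NNPP => Ph; apply: H; by exists h.
apply: (grows_step (h := h)) => //; last exact: prime_nzd.
by case: HP.
Qed.

(** Growth is built downwards from the top prime of the chain, each strict inclusion adding one by
    [grows_prime]. *)
Lemma chain_grows J r C : prime_chain J r C -> grows J r.
Proof.
case=> JC HC Hstep; apply: grows_sub JC _.
suff : forall j, (j <= r)%N -> grows (C (r - j)%N) j by move/(_ r (leqnn r)); rewrite subnn.
elim=> [_|j IH lt_jr].
  have [H1 H2 _] := HC r (leqnn r); rewrite subn0; exact: grows0.
have lt_r : (r - j.+1 < r)%N by lia.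
have := IH (ltnW lt_jr); have -> : (r - j = (r - j.+1).+1)%N by lia.
have [H1 H2] := Hstep _ lt_r.
apply: grows_prime => //; first exact: HC (ltnW lt_r).
by have [] := HC _ lt_r.
Qed.

Lemma grows_le J C s r : is_ideal J ->
  (forall m, spanned J (degle m) (C * (m.+1) ^ s)) -> grows J r -> (r <= s)%N.
Proof.
move=> HJ Hsp [c Hc]; rewrite leqNgt; apply/negP => lt_sr.
(* With this [M], [C * (c * M + 1) ^ s <= C * (c + 1) ^ s * M ^ s < M ^ s.+1]. *)
pose M := (C * (c.+1) ^ s).+1.
have [T [g [cT dg ig]]] := Hc M.
have := indep_card HJ ig dg (Hsp (c * M)%N); rewrite cT leqNgt => /negP; apply.
have M0 : (0 < M)%N by [].
apply: leq_trans (_ : M ^ s.+1 <= _)%N; last by rewrite leq_pexp2l.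
apply: leq_ltn_trans (_ : C * (c.+1 * M) ^ s < _)%N.
  rewrite leq_mul2l; case: (posnP s) => [->|s0]; first by rewrite !expn0 orbT.
  by rewrite leq_exp2r // mulSn -addn1 addnC leq_add2r M0 orbT.
by rewrite expnMn mulnA expnS ltn_pmul2r ?expn_gt0.
Qed.

(** A cube of exponents instead of the simplex of total degree at most [m]: the count [m.+1 ^ N] is
    immediate and has the same order of growth. *)
Definition box m (t : {ffun 'I_N -> 'I_m.+1}) : 'X_{1..N} :=
  [multinom (t i : nat) | i < N].

Lemma degle_span m p : degle m p -> p = \sum_t p@_(box t) *: 'X_[box (m := m) t].
Proof.
move=> dp.
apply/mpolyP => mu; rewrite raddf_sum /=.
have [le_mu|gt_mu] := boolP [forall i, mu i < m.+1]%N; last first.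
  rewrite big1 => [|t _]; last first.
    rewrite mcoeffZ mcoeffX; case: eqP => [E|_]; last by rewrite mulr0.
    by case/negP: gt_mu; apply/forallP => i; rewrite -E mnmE.
  apply: memN_msupp_eq0; apply/negP => /msize_mdeg_lt lt_mu; case/negP: gt_mu.
  apply/forallP => i; apply: leq_ltn_trans (leq_trans lt_mu dp).
  by rewrite mdegE (bigD1 i) //= leq_addr.
pose t0 : {ffun 'I_N -> 'I_m.+1} := [ffun i => inord (mu i)].
have E0 : box t0 = mu.
  by apply/mnmP => i; rewrite mnmE ffunE inordK // (forallP le_mu).
rewrite (bigD1 t0) //= mcoeffZ mcoeffX E0 eqxx mulr1 big1 ?addr0 // => t nt.
rewrite mcoeffZ mcoeffX; case: eqP => [E|_]; last by rewrite mulr0.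
case/negP: nt; apply/eqP/ffunP => i; apply: val_inj; rewrite ffunE /= inordK.
  by rewrite -E mnmE.
exact: (forallP le_mu).
Qed.

Lemma grows_leN J r : is_ideal J -> grows J r -> (r <= N)%N.
Proof.
move=> HJ; apply: (@grows_le _ 1) => // m; rewrite mul1n.
exists {ffun 'I_N -> 'I_m.+1}, (fun t => 'X_[box t]).
rewrite card_ffun !card_ord; split=> // p /degle_span E.
by exists (fun t => p@_(box t)); rewrite -E subrr; apply: ideal0.
Qed.

Lemma not_grows1_algebraic J (z : S) : is_ideal J -> ~ grows J 1 ->
  exists m (c : 'I_m -> k), (exists i, c i != 0) /\ J (\sum_i c i *: z ^+ i).
Proof.
move=> HJ nG; apply: NNPP => H; apply: nG; exists (msize z) => M.
exists 'I_M, (fun i : 'I_M => z ^+ i); rewrite card_ord expn1; split=> // [i|c Hc i].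
  by apply: degleW (degleX i (degle_tdeg z)); rewrite mulnC leq_mul2l ltnW ?orbT.
apply: NNPP => /eqP ci; apply: H; exists M, c; split=> //; by exists i.
Qed.

(** This encodes [dim S/J <= s]. Quantifying over primes makes it pass to larger ideals and supplies
    the prime that [grows_prime] starts from. *)
Definition dimle J s := forall P, is_prime P -> subideal J P ->
  forall r, grows P r -> (r <= s)%N.

Lemma dimle_sub J Q s : subideal J Q -> dimle J s -> dimle Q s.
Proof. by move=> JQ HJ P HP QP; apply: HJ => // f /JQ/QP. Qed.

Lemma dimle_grows J s : (forall r, grows J r -> (r <= s)%N) -> dimle J s.
Proof. by move=> H P _ JP r /(grows_sub JP)/H. Qed.

Definition subspace (W : S -> Prop) := W 0 /\ forall u v c, W u -> W v -> W (u + c *: v).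

(** A line [w + x *: v] meets an ideal that does not contain both [w] and [v] in at most one point;
    an infinite field has an [x] off these finitely many exceptions. *)
Lemma avoid (W : S -> Prop) (Ps : list (S -> Prop)) : infinite_field k -> subspace W ->
  exists2 w, W w & forall P, List.In P Ps -> is_ideal P -> ~ subideal W P -> ~ P w.
Proof.
move=> Hk [W0 WD]; elim: Ps => [|Q Ps [w Ww Hw]]; first by exists 0.
have [HQ|nHQ] := classic (is_ideal Q /\ ~ subideal W Q); last first.
  by exists w => // P /= [<-|/Hw //] ? ?; case: nHQ.
case: HQ => HQ nWQ; have [v [Wv Qv]] : exists v, W v /\ ~ Q v.
  by apply: NNPP => H; apply: nWQ => v Wv; apply: NNPP => Qv; apply: H; exists v.
have bad P : exists b : k, is_ideal P -> ~ (P w /\ P v) ->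
    forall x, P (w + x *: v) -> x = b.
  have [[x Px]|H] := classic (exists x, P (w + x *: v)); last first.
    by exists 0 => _ _ x Px; case: H; exists x.
  exists x => HP nP y Py; apply: NNPP => /eqP nyx; apply: nP.
  have Pv : P v.
    have := idealB HP Py Px; rewrite opprD addrACA subrr add0r -scalerBl => H.
    have := idealZ (y - x)^-1 HP H; rewrite scalerA mulVf ?scale1r //.
    by rewrite subr_eq0.
  split=> //; apply: (idealDr HP (idealZ x HP Pv)); by rewrite addrC.
have [b Hb] := fun_choice bad.
have [x Hx] : exists x, x \notin map b (Q :: Ps).
  apply: NNPP => H; apply: Hk; exists (map b (Q :: Ps)) => x.
  by apply: contra_notT H => Hx; exists x.
have notin P L : List.In P L -> x \notin map b L -> x <> b P.
  elim: L => //= P' L IH [<-|/IH H]; rewrite inE negb_or => /andP [/eqP] // _; exact: H.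
exists (w + x *: v); first exact: WD.
move=> P HP iP nWP Pwx; apply: (notin P (Q :: Ps) HP Hx); apply: Hb => // -[Pw Pv].
case: HP => [E|HP]; first by apply: Qv; rewrite E.
exact: (Hw P).
Qed.

(** One [w] serves all ideals of the list, as the exchange argument requires. It avoids those of the
    finitely many primes from [prime_product_below] that do not contain [W]; a prime above one of
    these and containing [w] is strictly larger. Primes containing [W] are small by hypothesis. *)
Lemma dim_drop (W : S -> Prop) (Js : list ((S -> Prop) * nat)) :
  infinite_field k -> subspace W ->
  (forall J s, List.In (J, s) Js -> [/\ is_ideal J, dimle J s.+1 &
     forall P, is_prime P -> subideal J P -> subideal W P ->
       forall r, grows P r -> (r <= s)%N]) ->
  exists2 w, W w & forall J s, List.In (J, s) Js -> dimle (ideal_add J w) s.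
Proof.
move=> Hk HW HJs.
have [L HL] : exists L : list (S -> Prop), forall J s, List.In (J, s) Js ->
    forall Q, is_prime Q -> subideal J Q -> exists P,
     [/\ List.In P L, is_prime P, subideal J P & subideal P Q].
  elim: Js HJs => [|[J s] Js IH] HJs; first by exists [::].
  have [|L HL] := IH; first by move=> J' s' H; apply: HJs; right.
  have [|HJ _ _] := HJs J s; first by left.
  have [Ps [H1 H2]] := prime_product_below (@noetherian_mpoly k N) HJ.
  exists (Ps ++ L)%list => J' s' [[<- _]|HIn] Q HQ J'Q.
    have [i lt_i PQ] := prime_prod_in HQ J'Q H2.
    have [HP JP] := H1 i lt_i; exists (nth (fun=> True) Ps i); split=> //.
    apply: List.in_or_app; left; elim: (Ps) i lt_i {H1 H2 PQ HP JP} => // P Ps' IHP [|i] /=.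
      by left.
    by rewrite ltnS => /IHP; right.
  have [P [H3 H4 H5 H6]] := HL _ _ HIn Q HQ J'Q; exists P; split=> //.
  by apply: List.in_or_app; right.
have [w Ww Hw] := avoid L Hk HW; exists w => // J s HIn.
have [HJ dJ HP0] := HJs _ _ HIn.
move=> Q HQ JwQ r Gr.
have JQ : subideal J Q by move=> f Jf; apply: JwQ; apply: ideal_add_sub.
have Qw : Q w by apply: JwQ; apply: ideal_add_mem.
have [P [PL HP JP PQ]] := HL _ _ HIn Q HQ JQ.
have [WP|nWP] := classic (subideal W P); first exact: (HP0 P) (grows_sub PQ Gr).
have nPw : ~ P w by apply: Hw nWP => //; case: HP.
have iQ : is_ideal Q by case: HQ.
rewrite -ltnS; apply: (dJ P) => //; apply: (grows_prime HP iQ PQ _ Gr).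
by move/(_ w Qw).
Qed.

End Growth.

(** * Homogeneous ideals and regular sequences *)

Lemma mpoly_rmorph_congr (k : fieldType) n (R : comRingType) (J : R -> Prop)
    (f g : {rmorphism {mpoly k[n]} -> R}) : is_ideal J ->
  (forall c, f c%:MP = g c%:MP) -> (forall i, J (f 'X_i - g 'X_i)) ->
  forall p, J (f p - g p).
Proof.
move=> HJ HC HX p.
have HM (x y x' y' : R) : J (x - y) -> J (x' - y') -> J (x * x' - y * y').
  move=> H H'; have -> : x * x' - y * y' = x' * (x - y) + y * (x' - y') by ring.
  by apply: idealD => //; apply: ideal_mull.
rewrite [p]mpolyE !rmorph_sum -sumrB; apply: ideal_sum => // m _.
rewrite -mul_mpolyC !rmorphM HC -mulrBr; apply: ideal_mull => //.
rewrite mpolyXE_id !rmorph_prod; elim/big_ind2: _ => [|*|i _]; last first.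
- rewrite !rmorphXn; elim: (m i) => [|j IH]; last by rewrite !exprS; apply: HM.
  by rewrite !expr0 subrr; apply: ideal0.
- exact: HM.
- by rewrite subrr; apply: ideal0.
Qed.

Section RegularSeq.
Variable R : comRingType.
Implicit Types (J : R -> Prop) (f g u v w : R) (s t : seq R).

Lemma nzd_mod_ext J J' f : (forall p, J p <-> J' p) -> nzd_mod J f -> nzd_mod J' f.
Proof. by move=> E H g /E/H/E. Qed.

Lemma gen_eq_mem s t : s =i t -> forall p : R, gen_ideal s p <-> gen_ideal t p.
Proof. by move=> E p; split; apply: gen_sub => x; rewrite E. Qed.

Lemma regular_rcons s f :
  regular_seq (rcons s f) <-> regular_seq s /\ nzd_mod (gen_ideal s) f.
Proof.
split=> [H|[H Hf] i].
  split=> [i lt_i|].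
    have := H i; rewrite size_rcons nth_rcons lt_i -cats1 takel_cat ?(ltnW lt_i) //.
    by apply; apply: ltnW.
  have := H (size s); rewrite size_rcons nth_rcons ltnn eqxx -cats1 take_size_cat //.
  exact.
rewrite size_rcons ltnS leq_eqVlt => /orP[/eqP->|lt_i].
  by rewrite nth_rcons ltnn eqxx -cats1 take_size_cat.
by rewrite nth_rcons lt_i -cats1 takel_cat ?(ltnW lt_i) //; apply: H.
Qed.

Lemma regular_catl s t : regular_seq (s ++ t) -> regular_seq s.
Proof.
elim/last_ind: t => [|t f IH]; first by rewrite cats0.
by rewrite -rcons_cat => /regular_rcons [/IH].
Qed.

(** Modulo [s], the power [w ^+ m] is a non-zero-divisor and a multiple of [v], so [v] is no zero
    divisor either. *)
Lemma nzd_exchange s w v m : regular_seq (rcons s w) ->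
  gen_ideal (rcons s v) (w ^+ m) -> regular_seq (rcons s v).
Proof.
move=> /regular_rcons [Hs Hw] /gen_rcons [q [r [Jq E]]]; apply/regular_rcons; split=> //.
have HJ := gen_is_ideal s; move=> g Jvg.
have : gen_ideal s (w ^+ m * g).
  rewrite E mulrDl -mulrA; apply: idealD => //; [exact: ideal_mulr | exact: ideal_mull].
elim: m {E} => [|m IH]; first by rewrite expr0 mul1r.
by rewrite exprS -mulrA => /Hw/IH.
Qed.

End RegularSeq.

Section Graded.
Variables (k : fieldType) (N : nat).
Local Notation S := {mpoly k[N]}.
Implicit Types (I J P Q : S -> Prop) (f g h p q u v : S) (s t a b : seq S).

Definition graded J := forall f d, J f -> J (pihomog mdeg d f).

Lemma sum_pihomog f : f = \sum_(d < msize f) pihomog mdeg d f.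
Proof. exact: pihomog_partitionE. Qed.

Lemma pihomogMr f g e d : g \is e.-homog ->
  pihomog mdeg d (f * g) = if (e <= d)%N then pihomog mdeg (d - e) f * g else 0.
Proof.
move=> Hg; have Hi i : pihomog mdeg i f * g \is (i + e).-homog.
  by apply: dhomogM => //; apply: pihomogP.
rewrite {1}[f]sum_pihomog mulr_suml raddf_sum /=.
have [le_ed|lt_de] := leqP e d; last first.
  apply: big1 => i _; apply: (pihomog_ne0 _ (Hi i)).
  by rewrite gtn_eqF // ltn_addl.
have other (i : nat) : i != (d - e)%N -> pihomog mdeg d (pihomog mdeg i f * g) = 0.
  move=> ni; apply: (pihomog_ne0 _ (Hi i)); apply: contra_neq ni => <-; by rewrite addnK.
have same : pihomog mdeg d (pihomog mdeg (d - e) f * g) = pihomog mdeg (d - e) f * g.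
  by apply: pihomog_dE; have := Hi (d - e)%N; rewrite subnK.
have [lt_f|le_f] := ltnP (d - e) (msize f).
  rewrite (bigD1 (Ordinal lt_f)) //= same big1 ?addr0 // => i ni; apply: other.
  by apply: contra_neq ni => E; apply: val_inj.
rewrite big1 => [|i _]; last by apply: other; rewrite ltn_eqF // (leq_trans (ltn_ord i)).
suff -> : pihomog mdeg (d - e) f = 0 by rewrite mul0r.
rewrite pihomogE big_seq_cond; apply: big1 => m /andP [/msize_mdeg_lt lt_m /eqP Em].
by move: le_f; rewrite leqNgt -Em lt_m.
Qed.

Lemma gradedP J f : is_ideal J -> (forall d, J (pihomog mdeg d f)) -> J f.
Proof. by move=> HJ H; rewrite [f]sum_pihomog; apply: ideal_sum. Qed.

Lemma graded_add J f e : is_ideal J -> graded J -> f \is e.-homog -> graded (ideal_add J f).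
Proof.
move=> HJ gJ Hf _ d [q [r [Jq ->]]]; rewrite raddfD /= (pihomogMr _ _ Hf).
have Jd := gJ _ d Jq; case: ifP => _; last by rewrite addr0; apply: ideal_add_sub.
by exists (pihomog mdeg d q), (pihomog mdeg (d - e) r).
Qed.

Definition pos_homog f := exists2 e, (0 < e)%N & f \is e.-homog.

Lemma graded_gen s : (forall f, f \in s -> exists e, f \is e.-homog) -> graded (gen_ideal s).
Proof.
elim: s => [_ f d /gen_nil ->|f s IH Hs g d /gen_cons H].
  by apply/gen_nil; rewrite raddf0.
have [e He] := Hs f (mem_head _ _).
apply/gen_cons; apply: (graded_add _ _ He) H; first exact: gen_is_ideal.
by apply: IH => h hs; apply: Hs; rewrite inE hs orbT.
Qed.

Lemma graded_gen_pos s : (forall f, f \in s -> pos_homog f) -> graded (gen_ideal s).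
Proof. by move=> H; apply: graded_gen => f /H [e _]; exists e. Qed.

(* Graded Nakayama: an element of every J + u^j S lies in J. *)
Lemma nzd_swap J u v : is_ideal J -> graded J -> pos_homog u ->
  nzd_mod J u -> nzd_mod (ideal_add J u) v ->
  nzd_mod J v /\ nzd_mod (ideal_add J v) u.
Proof.
move=> HJ gJ [e e0 He] Ju Jv; split=> [m Jvm|g [q [r [Jq E]]]].
  have div g : J (v * g) -> exists q r, [/\ J q, g = q + r * u & J (v * r)].
    move=> Jvg; have [|q [r [Jq E]]] := Jv g; first exact: ideal_add_sub.
    exists q, r; split=> //; apply: Ju; have -> : u * (v * r) = v * g - v * q by rewrite E; ring.
    by apply: idealB => //; apply: ideal_mull.
  have divn j : exists q r, [/\ J q, m = q + r * u ^+ j & J (v * r)].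
    elim: j => [|j [q [r [Jq E Jr]]]]; first by exists 0, m; split=> //; [apply: ideal0 | rewrite expr0 mulr1 add0r].
    have [q' [r' [Jq' E' Jr']]] := div r Jr.
    exists (q + q' * u ^+ j), r'; split=> //; last by rewrite E E' exprS; ring.
    by apply: idealD => //; apply: ideal_mulr.
  apply: gradedP => // d; have [q [r [Jq -> _]]] := divn d.+1.
  rewrite raddfD /= (pihomogMr _ _ (dhomogMn d.+1 He)).
  have -> : (e * d.+1 <= d)%N = false by apply/negbTE; rewrite -ltnNge leq_pmull.
  by rewrite addr0; apply: gJ.
have [q' [r' [Jq' E']]] : ideal_add J u r.
  apply: Jv; exists (- q), g; split; first exact: idealN.
  by rewrite [g * u]mulrC E; ring.
exists (g - r' * v), r'; split; last by rewrite subrK.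
apply: Ju; have -> : u * (g - r' * v) = q + q' * v.
  by rewrite mulrBr E E'; ring.
by apply: idealD => //; apply: ideal_mulr.
Qed.

Lemma regular_swap s t u v : (forall f, f \in s ++ u :: v :: t -> pos_homog f) ->
  regular_seq (s ++ u :: v :: t) -> regular_seq (s ++ v :: u :: t).
Proof.
elim/last_ind: t => [|t w IH] Hh; last first.
  rewrite -!rcons_cons -!rcons_cat => /regular_rcons [H1 H2]; apply/regular_rcons; split.
    apply: IH H1 => f Hf; apply: Hh; rewrite -!rcons_cons -!rcons_cat mem_rcons inE Hf orbT //.
  apply: nzd_mod_ext H2; apply: gen_eq_mem => x.
  by rewrite !mem_cat !inE; congr (_ || _); rewrite orbCA.
have -> x y : s ++ [:: x; y] = rcons (rcons s x) y by rewrite -!cats1 -catA.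
move=> /regular_rcons [/regular_rcons [H1 H2] H3].
have [|||||H4 H5] := @nzd_swap (gen_ideal s) u v.
- exact: gen_is_ideal.
- by apply: graded_gen_pos => f fs; apply: Hh; rewrite mem_cat fs.
- by apply: Hh; rewrite mem_cat !inE eqxx orbT.
- exact: H2.
- by apply: nzd_mod_ext H3 => p; apply: gen_rcons.
have -> : s ++ [:: v; u] = rcons (rcons s v) u by rewrite -!cats1 -catA.
apply/regular_rcons; split; first exact/regular_rcons.
by apply: nzd_mod_ext H5 => p; split=> /gen_rcons.
Qed.

Lemma regular_move s t u : (forall f, f \in s ++ u :: t -> pos_homog f) ->
  regular_seq (s ++ u :: t) -> regular_seq (s ++ rcons t u).
Proof.
elim: t s => [|v t IH] s Hh; first by [].
move=> /(regular_swap Hh) H.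
have E w : s ++ v :: w = (rcons s v) ++ w by rewrite cat_rcons.
rewrite rcons_cons E; apply: IH; last by rewrite -E.
move=> f; rewrite -E => Hf; apply: Hh; move: Hf.
by rewrite !mem_cat !inE; congr (_ || _); rewrite orbCA.
Qed.

(** The elements of the prefix are moved one by one to the end, where they can be cut off. *)
Lemma regular_catr s t : (forall f, f \in s ++ t -> pos_homog f) ->
  regular_seq (s ++ t) -> regular_seq t.
Proof.
elim: s t => [//|u s IH] t Hh /(@regular_move [::] (s ++ t) u Hh) /=.
move=> /regular_rcons [H _].
by apply: IH H => f Hf; apply: Hh; rewrite inE Hf orbT.
Qed.

(** Modulo each of finitely many primes [z] is algebraic over [k]; the product of the equations is a
    [p != 0] with [p(z)] in [J]. As [J] is graded and [z] has positive degree, the top term of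
    [p(z)] alone is in [J]. *)
Lemma nilpotent_mod J (z : S) : is_ideal J -> graded J -> dimle J 0 -> pos_homog z ->
  exists m, J (z ^+ m).
Proof.
move=> HJ gJ dJ [e e0 He].
have [Ps [H1 H2]] := prime_product_below (@noetherian_mpoly k N) HJ.
pose ev (p : {poly k}) : S := (map_poly (@mpolyC N k) p).[z].
have Hp i : exists p : {poly k}, (i < size Ps)%N -> p != 0 /\ nth (fun=> True) Ps i (ev p).
  case: (ltnP i (size Ps)) => [lt_i|_]; last by exists 0.
  have [HP JP] := H1 i lt_i; have [iP _ _] := HP.
  have nG : ~ grows (nth (fun=> True) Ps i) 1 by move/(dJ _ HP JP).
  have [m [c [[j cj] Hc]]] := not_grows1_algebraic z iP nG.
  pose p := \poly_(i < m) (if insub i is Some j then c j else 0).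
  exists p => _; split.
    apply: contra_neq cj => E; have := congr1 (fun q : {poly k} => q`_j) E.
    by rewrite /= coef_poly ltn_ord valK coef0.
  suff -> : ev p = \sum_i c i *: z ^+ i by [].
  rewrite /ev (@horner_coef_wide _ m); last first.
    by apply: leq_trans (size_poly _ _) (size_poly _ _).
  by apply: eq_bigr => i' _; rewrite coef_map /= coef_poly ltn_ord valK mul_mpolyC.
have [P HP] := fun_choice Hp.
pose p := \prod_(i < size Ps) P i.
have p0 : p != 0 by apply/prodf_neq0 => i _; case: (HP i (ltn_ord i)).
have Jp : J (ev p).
  have -> : ev p = \prod_(i < size Ps) ev (P i).
    by rewrite /ev rmorph_prod horner_prod.
  by apply: (H2 (fun i => ev (P i))) => i /HP [].
pose i := (size p).-1; exists i.
have /(idealZ (p`_i)^-1 HJ) : J (p`_i *: z ^+ i); last first.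
  by rewrite scalerA mulVf ?scale1r // -lead_coefE lead_coef_eq0.
have := gJ _ (e * i)%N Jp; congr J.
rewrite /ev (@horner_coef_wide _ (size p)) ?size_poly // raddf_sum /=.
have Hz j : (p`_j)%:MP * z ^+ j \is (e * j).-homog.
  by rewrite mul_mpolyC; apply: dhomogZ; apply: dhomogMn.
have lt_i : (i < size p)%N by rewrite /i prednK // size_poly_gt0.
rewrite (bigD1 (Ordinal lt_i)) //= coef_map /= pihomog_dE // mul_mpolyC big1 ?addr0 // => j nj.
rewrite coef_map; apply: (pihomog_ne0 _ (Hz j)).
by rewrite eqn_pmul2l //; apply: contra_neq nj => E; apply: val_inj.
Qed.

Lemma exchange_all a b T : size a = N -> (T <= N)%N -> (T <= size b)%N ->
  (forall f, f \in a ++ b -> pos_homog f) -> regular_seq a ->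
  (forall t : nat, (t < T)%N -> dimle (gen_ideal (take (N - t.+1) a ++ take t.+1 b)) 0) ->
  regular_seq (take (N - T) a ++ take T b).
Proof.
move=> sa TN; elim: T TN => [|T IH] TN Tb Hh Ra Hd.
  by rewrite subn0 take0 cats0 take_oversize // sa.
have H1 : regular_seq (take (N - T) a ++ take T b).
  by apply: IH => //; try exact: ltnW; move=> t lt_t; apply: Hd; apply: ltnW.
have ET : (N - T = (N - T.+1).+1)%N by lia.
have HA i f : f \in take i a -> pos_homog f.
  by move/mem_take => fa; apply: Hh; rewrite mem_cat fa.
have HB i f : f \in take i b -> pos_homog f.
  by move/mem_take => fb; apply: Hh; rewrite mem_cat fb orbT.
pose x := nth 0 a (N - T.+1); pose y := nth 0 b T.
have Ex : take (N - T) a = rcons (take (N - T.+1) a) x.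
  by rewrite ET (take_nth 0) // sa; lia.
have Ey : take T.+1 b = rcons (take T b) y by rewrite (take_nth 0).
rewrite Ex cat_rcons in H1; rewrite Ey -rcons_cat.
have Hx : pos_homog x by apply: (HA (N - T)%N); rewrite Ex mem_rcons mem_head.
(* The old entry [x] is nilpotent modulo the new ideal, which has dimension 0; moved to the end of
   the sequence it can be exchanged for [y]. *)
have [|m Hm] := @nilpotent_mod _ x (gen_is_ideal _) _ (Hd T (ltnSn _)) Hx.
  by apply: graded_gen_pos => f; rewrite mem_cat => /orP[/HA|/HB].
apply: (nzd_exchange (w := x) (m := m)); last by rewrite rcons_cat -Ey.
rewrite rcons_cat; apply: regular_move H1 => f; rewrite mem_cat inE.
by case/or3P => [/HA|/eqP->|/HB].
Qed.

End Graded.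

(** * Generic linear forms and the Cohen-Macaulay property *)

Section Generic.
Variables (k : fieldType) (N : nat).
Hypothesis Hk : infinite_field k.
Local Notation S := {mpoly k[N]}.
Implicit Types (J P : S -> Prop) (g : seq S).

Lemma homog_subspace m : subspace (fun p : S => p \is m.-homog).
Proof. by split=> [|u v c Hu Hv]; [apply: dhomog0 | apply: rpredD => //; apply: rpredZ]. Qed.

Lemma dhomog_var i : ('X_i : S) \is 1.-homog.
Proof. by rewrite dhomogX; apply/eqP/mdeg1. Qed.

Lemma grows_irrelevant P r : is_ideal P -> (forall i, P 'X_i) -> grows P r -> (r <= 0)%N.
Proof.
move=> HP PX; apply: (@grows_le _ _ _ 1) => // m; rewrite muln1.
exists unit, (fun=> 1); rewrite card_unit; split=> // p _; exists (fun=> p.@[fun=> 0]).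
rewrite (big_pred1 tt) => [|[]//].
have := mpoly_rmorph_congr (f := idfun) (g := @mpolyC N k \o meval (fun=> 0)) HP.
rewrite /= -mul_mpolyC mulr1; apply => [c|i] /=; first by rewrite mevalC.
by rewrite mevalXU mpolyC0 subr0.
Qed.

Lemma generic_linear q (gs : list (seq S * nat)) :
  (forall g s, List.In (g, s) gs -> dimle (gen_ideal g) s) ->
  exists zs : seq S, [/\ size zs = q, forall z, z \in zs -> z \is 1.-homog &
    forall g s, List.In (g, s) gs -> forall j, (j <= q)%N -> (j <= s)%N ->
      dimle (gen_ideal (g ++ take j zs)) (s - j)].
Proof.
elim: q gs => [|q IH] gs Hgs.
  exists [::]; split=> // g s H j; rewrite leqn0 => /eqP-> _; rewrite cats0 subn0.
  exact: Hgs.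
(* Pairs with [s = 0] are set aside: only [j = 0] concerns them, and no dimension is left to cut. *)
pose Js := List.map (fun x => (gen_ideal x.1, x.2.-1)) (List.filter (fun x => 0 < x.2)%N gs).
have [|z Hz Hd] := dim_drop (Js := Js) Hk (homog_subspace 1).
  move=> J s /List.in_map_iff [[g s'] [[<- <-] /List.filter_In [Hin /= s0]]].
  split; first exact: gen_is_ideal.
    by rewrite prednK //; apply: Hgs.
  move=> P [HP _ _] _ HW r Hr; apply: leq_trans (leq0n _); apply: grows_irrelevant Hr => // i.
  exact/HW/dhomog_var.
pose gs' := List.map (fun x => (rcons x.1 z, x.2.-1)) (List.filter (fun x => 0 < x.2)%N gs).
have [|zs [sz Hzs Hd']] := IH gs'.
  move=> g s /List.in_map_iff [[g' s'] [[<- <-] /= Hin]].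
  have /Hd : List.In (gen_ideal g', s'.-1) Js by apply: List.in_map Hin.
  by apply: dimle_sub => p /gen_rcons.
exists (z :: zs); split=> [|u|g s Hin [|j]]; first by rewrite /= sz.
- by rewrite inE => /orP[/eqP->|/Hzs].
- by move=> _ _; rewrite take0 cats0 subn0; apply: Hgs.
rewrite ltnS => le_jq lt_js; have s0 : (0 < s)%N by apply: leq_trans lt_js.
rewrite /= -cat_rcons; have -> : (s - j.+1 = s.-1 - j)%N by lia.
apply: Hd' => //; last by lia.
apply: (List.in_map (fun x : seq S * nat => (rcons x.1 z, x.2.-1)) _ (g, s)).
exact/List.filter_In.
Qed.

Definition vars : seq S := [seq 'X_i | i <- enum 'I_N].

Lemma regular_vars : regular_seq vars.
Proof.
move=> t; rewrite size_map size_enum_ord => lt_t.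
have nthX j (lt_j : (j < N)%N) : vars`_j = 'X_(Ordinal lt_j).
  by rewrite (nth_map (Ordinal lt_j)) ?size_enum_ord // -[j]/(val (Ordinal lt_j)) nth_ord_enum.
have tN : (t <= size vars)%N by rewrite size_map size_enum_ord ltnW.
(* The map [th] kills the first [t] variables, and its kernel is the ideal they generate; regularity
   of the next variable then follows from [S] being a domain. *)
pose v (i : 'I_N) : S := if (i < t)%N then 0 else 'X_i.
pose th : {rmorphism S -> S} := mmap (@mpolyC N k) v.
have thX i : th 'X_i = v i by rewrite /th /= mmapX mmap1U.
have thC c : th c%:MP = c%:MP by rewrite /th /= mmapC.
have HJ := gen_is_ideal (take t vars).
have kerth p : gen_ideal (take t vars) p <-> th p = 0.
  split=> [|E].
    move: p; apply: gen_min.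
      split=> [|f g Ef Eg|r f Ef]; rewrite ?rmorph0 ?rmorphD ?rmorphM ?Ef ?Eg ?addr0 ?mulr0 //.
    move=> f /(nthP 0) [j]; rewrite size_takel // => lt_j <-.
    by rewrite nth_take // (nthX _ (ltn_trans lt_j lt_t)) thX /v /= lt_j.
  have := mpoly_rmorph_congr (f := idfun) (g := th) HJ.
  move=> /(_ _ _ p); rewrite /= E subr0; apply=> [c|i]; first by rewrite thC.
  rewrite thX /v; case: ltnP => [lt_i|_]; last by rewrite subrr; apply: ideal0.
  rewrite subr0; apply: gen_mem; have -> : 'X_i = vars`_i by rewrite (nthX i (ltn_ord i)); congr 'X_(_); apply: val_inj.
  by rewrite -(nth_take _ lt_i) mem_nth // size_takel.
move=> g /kerth; rewrite rmorphM (nthX t lt_t) thX /v /= ltnn => /eqP.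
rewrite mulf_eq0 => /orP[/eqP E|/eqP/kerth //].
have /eqP := congr1 (fun p : S => p@_U_(Ordinal lt_t)) E.
by rewrite mcoeffX eqxx mcoeff0 oner_eq0.
Qed.

Lemma grows_regular g r : regular_seq g ->
  grows (gen_ideal g) r -> (r + size g <= N)%N.
Proof.
elim/last_ind: g r => [|g f IH] r.
  by move=> _ /(grows_leN (gen_is_ideal _)); rewrite addn0.
move=> /regular_rcons [Hg Hf] Hr; rewrite size_rcons addnS -addSn; apply: IH => //.
apply: (grows_step (h := f)) Hr; try exact: gen_is_ideal; last exact: Hf.
  by apply: gen_sub => x; rewrite mem_rcons inE orbC => ->.
by apply: gen_mem; rewrite mem_rcons mem_head.
Qed.

(* Cohen-Macaulayness of S, by exchange: the variables are traded for generic
   linear forms, and these in turn for the elements of g. *)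
Theorem regular_of_dim (g : seq S) : (size g <= N)%N ->
  (forall f, f \in g -> pos_homog f) ->
  (forall t, (t <= size g)%N -> dimle (gen_ideal (take t g)) (N - t)) ->
  regular_seq g.
Proof.
move=> gN Hg Hd.
pose pre (h : seq S) := [seq (take t h, (N - t)%N) | t <- iota 0 (size h).+1].
have preP h t : (t <= size h)%N -> List.In (take t h, (N - t)%N) (pre h).
  rewrite -ltnS => lt_t; rewrite /pre.
  have : t \in iota 0 (size h).+1 by rewrite mem_iota.
  elim: (iota _ _) => // x s IH; rewrite inE => /orP[/eqP->|/IH]; [by left | by right].
have inpre h g' s : List.In (g', s) (pre h) ->
    exists2 t, (t <= size h)%N & g' = take t h /\ s = (N - t)%N.
  have mL x : x \in iota 0 (size h).+1 -> (x <= size h)%N by rewrite mem_iota.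
  rewrite /pre; elim: (iota 0 (size h).+1) mL => //= x l IH mL [[<- <-]|].
    by exists x => //; apply: mL; apply: mem_head.
  by apply: IH => y yl; apply: mL; rewrite inE yl orbT.
have sv : size vars = N by rewrite size_map size_enum_ord.
have Hv f : f \in vars -> pos_homog f.
  by case/mapP => i _ ->; exists 1%N => //; apply: dhomog_var.
have [|zs [sz Hz Hzd]] := @generic_linear N (pre vars ++ pre g)%list.
  move=> g' s /List.in_app_iff [] /inpre [t le_t [-> ->]]; last exact: Hd.
  apply: dimle_grows => r /grows_regular.
  have Rt : regular_seq (take t vars).
    by have := regular_vars; rewrite -{1}(cat_take_drop t vars) => /regular_catl.
  move/(_ Rt); rewrite size_takel //; lia.
have Hz' f : f \in zs -> pos_homog f by move/Hz; exists 1%N.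
have Rz : regular_seq zs.
  have := @exchange_all k N vars zs N; rewrite subnn take0 [take N zs]take_oversize ?sz //; apply=> //.
  - by move=> f; rewrite mem_cat => /orP[/Hv|/Hz'].
  - exact: regular_vars.
  - move=> t lt_t; have -> : 0%N = (N - (N - t.+1) - t.+1)%N by lia.
    apply: Hzd; [apply: List.in_or_app; left; apply: preP | |]; rewrite ?sv; lia.
(* Only the last [size g] linear forms are exchanged; [regular_catr] then removes the [N - size g]
   that remain in front. *)
have := @exchange_all k N zs g (size g); rewrite take_size => H.
apply: regular_catr (H _ _ _ _ _ _) => //.
- by move=> f; rewrite mem_cat => /orP[/mem_take/Hz'|/Hg].
- by move=> f; rewrite mem_cat => /orP[/Hz'|/Hg].
- move=> t lt_t; apply: (@dimle_sub _ _ (gen_ideal (take t.+1 g ++ take (N - t.+1) zs))).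
    by apply: gen_sub => x; rewrite !mem_cat orbC.
  have -> : 0%N = (N - t.+1 - (N - t.+1))%N by lia.
  apply: Hzd; [apply: List.in_or_app; right; exact: preP | |]; lia.
Qed.

End Generic.

(** * Noether normalization *)

Section HilbertGrowth.
Variables (k : fieldType) (n : nat).
Local Notation S := {mpoly k[n.+1]}.
Implicit Types (I J P : S -> Prop) (f g p q : S).

Lemma hilbert_spanned I m r : is_ideal I -> hilbert_fun I m r ->
  spanned I (fun p => p \is m.-homog) r.
Proof.
move=> HI [[gs [<- [hgs igs]]] Hmax]; exists 'I_(size gs), (fun i : 'I_(size gs) => gs`_i).
rewrite card_ord; split=> // p Hp; apply: NNPP => H.
have := Hmax (p :: gs); rewrite /= ltnn => /(_ _)/negP; apply=> //; split.
  by move=> g; rewrite inE => /orP[/eqP->|/hgs].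
move=> c; rewrite /= big_ord_recl /= => Hc.
have c0 : c ord0 = 0.
  apply: NNPP => /eqP c0; apply: H; exists (fun i : 'I_(size gs) => - (c ord0)^-1 * c (lift ord0 i)).
  have := idealZ (c ord0)^-1 HI Hc; rewrite scalerDr scalerA mulVf // scale1r.
  congr (I (_ + _)); rewrite scaler_sumr -sumrN; apply: eq_bigr => i _.
  by rewrite scalerA mulNr scaleNr opprK.
move: Hc; rewrite c0 scale0r add0r => /igs Hc i.
by case: (unliftP ord0 i) => [j ->|->].
Qed.

Lemma spanned_degle I (a : nat -> nat) : is_ideal I ->
  (forall m, spanned I (fun p => p \is m.-homog) (a m)) ->
  forall m, spanned I (degle m) (\sum_(j < m.+1) a j).
Proof.
move=> HI Ha; elim=> [|m [T [e [cT He]]]].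
  have [T [e [cT He]]] := Ha 0%N; exists T, e; rewrite big_ord1; split=> // p dp.
  by apply: He; rewrite [p]msize1_polyC // -[_%:MP]mulr1 mul_mpolyC; apply/rpredZ/dhomog1.
have [T' [e' [cT' He']]] := Ha m.+1.
exists (T + T')%type, (fun x => match x with inl t => e t | inr t => e' t end).
rewrite card_sum big_ord_recr leq_add //; split=> // p dp.
have Hq : degle m (p - pihomog mdeg m.+1 p).
  rewrite {1}(pihomog_partitionE dp) big_ord_recr /= addrK.
  apply: degle_sum => i _; apply: degleW (degle_homog (pihomogP _ _ _)).
  by rewrite -ltnS.
have [c Hc] := He _ Hq; have [c' Hc'] := He' _ (pihomogP mdeg m.+1 p).
exists (fun x => match x with inl t => c t | inr t => c' t end).
rewrite big_sumType /=; have := idealD HI Hc Hc'; congr I.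
by rewrite opprD addrACA subrK.
Qed.

Lemma poly_bound (Pl : {poly rat}) d : (size Pl <= d.+1)%N ->
  exists B : nat, forall m, (Pl.[m%:R] <= (B * m.+1 ^ d)%:R)%R.
Proof.
move=> sP; pose B := Num.bound (\sum_(i < d.+1) `|Pl`_i|).
exists B => m; rewrite (horner_coef_wide _ sP) natrM.
apply: le_trans (_ : (\sum_(i < d.+1) `|Pl`_i|) * (m.+1 ^ d)%:R <= _); last first.
  rewrite ler_wpM2r ?ler0n //; apply/ltW/archi_boundP.
  exact: sumr_ge0.
rewrite mulr_suml; apply: ler_sum => i _.
apply: le_trans (ler_norm _) _; rewrite normrM ler_wpM2l // -natrX normr_nat ler_nat.
apply: leq_trans (_ : m.+1 ^ i <= _)%N; last by rewrite leq_pexp2l // -ltnS.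
by case: (nat_of_ord i) => // j; rewrite leq_exp2r.
Qed.

Lemma hilbert_poly_grows I Pl d : is_ideal I -> hilbert_poly I Pl ->
  (size Pl <= d.+1)%N -> forall r, grows I r -> (r <= d.+1)%N.
Proof.
move=> HI [m0 Hm] sP; have [B HB] := poly_bound sP.
(* [B] serves the degrees from [m0] on; below [m0] the whole box of exponents is counted, with at
   most [m0.+1 ^ n.+1] elements. *)
pose C := (B + m0.+1 ^ n.+1)%N.
have sp m : spanned I (fun p => p \is m.-homog) (C * m.+1 ^ d).
  have [le_m|lt_m] := leqP m0 m.
    have [r [Hr Er]] := Hm m le_m.
    have [T [e [cT He]]] := hilbert_spanned HI Hr; exists T, e; split=> //.
    apply: leq_trans cT _; apply: leq_trans (_ : B * m.+1 ^ d <= _)%N.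
      by rewrite -(ler_nat rat) -Er.
    by rewrite leq_mul2r leq_addr orbT.
  exists {ffun 'I_n.+1 -> 'I_m.+1}, (fun t => 'X_[box t]); split.
    rewrite card_ffun !card_ord; apply: leq_trans (_ : C <= _)%N.
      by apply: leq_trans (leq_addl _ _); rewrite leq_exp2r // ltnW.
    by rewrite leq_pmulr // expn_gt0.
  move=> p /degle_homog/degle_span E; exists (fun t => p@_(box t)).
  by rewrite -E subrr; apply: ideal0.
move=> r; apply: (@grows_le _ _ _ C) => // m.
have [T [e [cT He]]] := spanned_degle HI sp m; exists T, e; split=> //.
apply: leq_trans cT _; rewrite expnSr mulnA mulnC.
apply: leq_trans (_ : \sum_(j < m.+1) C * m.+1 ^ d <= _)%N.
  apply: leq_sum => j _; rewrite leq_mul2l; case: (d) => [|d']; first by rewrite !expn0 orbT.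
  by rewrite leq_exp2r ?ltn_ord ?orbT.
by rewrite sum_nat_const card_ord mulnC.
Qed.

End HilbertGrowth.

Section Finite.
Variables (k : fieldType) (N s : nat).
Local Notation S := {mpoly k[N]}.
Local Notation A := {mpoly k[s]}.
Implicit Types (I J P : S -> Prop) (f g p q : S).

Variable y : 'I_s -> S.
Definition iota_alg : {rmorphism A -> S} := mmap (@mpolyC N k) y.
Local Notation io := iota_alg.

Lemma iota_algC c : io c%:MP = c%:MP. Proof. by rewrite /= mmapC. Qed.
Lemma iota_algZ c a : io (c *: a) = c *: io a.
Proof. by rewrite -mul_mpolyC rmorphM iota_algC mul_mpolyC. Qed.
Lemma iota_algX i : io 'X_i = y i. Proof. by rewrite /= mmapX mmap1U. Qed.

Lemma iota_algM a b : io (a * b) = io a * io b. Proof. exact: rmorphM. Qed.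
Lemma iota_algD a b : io (a + b) = io a + io b. Proof. exact: rmorphD. Qed.
Lemma iota_algN a : io (- a) = - io a. Proof. exact: rmorphN. Qed.
Lemma iota_algXn a m : io (a ^+ m) = io a ^+ m. Proof. exact: rmorphXn. Qed.

(** Finite generation over [A] alone would not allow counting over [k]; the bound on the degrees of
    the coefficients is what [spans_over_grows] counts with. *)
Definition spans_over J (E : finType) (e : E -> S) := forall m f, degle m f ->
  exists al : E -> A, (forall x, degle m (al x)) /\ J (f - \sum_x io (al x) * e x).

Lemma spans_over_sub J P (E : finType) (e : E -> S) : subideal J P ->
  spans_over J e -> spans_over P e.
Proof.
by move=> JP H m f /H [al [H1 H2]]; exists al; split=> //; apply: JP.
Qed.

Lemma coef_box_eq0 m (a : A) : degle m a ->
  (forall t : {ffun 'I_s -> 'I_m.+1}, a@_(box t) = 0) -> a = 0.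
Proof. by move=> /degle_span E H; rewrite E; apply: big1 => t _; rewrite H scale0r. Qed.

(* Multiplying an independent family by the powers of a raises the growth beyond
   what the free A-module on E allows. *)
Lemma spans_over_grows P (E : finType) (e : E -> S) a r : is_ideal P ->
  spans_over P e -> a != 0 -> P (io a) -> grows P r -> (r < s)%N.
Proof.
move=> HP He a0 Pa [c Hc]; rewrite ltnNge; apply/negP => le_sr.
(* The products [a ^+ i * al t z] have degree at most [D * M], which leaves at most
   [#|E| * (D * M + 1) ^ s] coordinates; this [M] makes that smaller than [M ^ r.+1], the number of
   pairs [(i, t)]. *)
pose D := (msize a + c)%N; pose M := (#|E| * (D.+1) ^ s).+1.
have [T [g [cT dg ig]]] := Hc M.
have [al Hal] := fun_choice (fun t => He _ _ (dg t)).
pose dom := (D * M)%N.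
pose w (x : 'I_M * T) z := a ^+ x.1 * al x.2 z.
have dw x z : degle dom (w x z).
  apply: degleW (degleM (degleX x.1 (degle_tdeg a)) ((Hal x.2).1 z)).
  by rewrite /dom mulnDl leq_add2r mulnC leq_mul2l ltnW ?orbT.
have [|b [[x0 bx] Hb]] := @exists_relation k ('I_M * T)%type (E * {ffun 'I_s -> 'I_dom.+1})%type
    (fun x zt => (w x zt.1)@_(box zt.2)).
  rewrite !card_prod card_ffun !card_ord cT -expnS.
  have M0 : (0 < M)%N by [].
  apply: leq_trans (_ : M ^ s.+1 <= _)%N; last by rewrite leq_pexp2l.
  apply: leq_ltn_trans (_ : #|E| * (D.+1 * M) ^ s < _)%N.
    rewrite leq_mul2l; case: (posnP s) => [->|s0]; first by rewrite !expn0 orbT.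
    by rewrite leq_exp2r // mulSn -addn1 addnC leq_add2r M0 orbT.
  by rewrite expnMn mulnA expnS ltn_pmul2r ?expn_gt0.
pose G (i : nat) z : A := \sum_t (if insub i is Some j then b (j, t) else 0) *: al t z.
have GP i : P (\sum_z io (G i z) * e z) ->
    forall t, (if insub i is Some j then b (j, t) else 0) = 0 :> k.
  move=> H; apply: ig; set cc := fun t => (if insub i is Some j then b (j, t) else 0) in H *.
  have E1 : \sum_z io (G i z) * e z = \sum_t cc t *: \sum_z io (al t z) * e z.
    have E2 z : io (G i z) * e z = \sum_t cc t *: (io (al t z) * e z).
      rewrite raddf_sum mulr_suml; apply: eq_bigr => t _.
      by rewrite scalerAl; congr (_ * _); apply: iota_algZ.
    transitivity (\sum_z \sum_t cc t *: (io (al t z) * e z)).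
      by apply: eq_bigr => z _; apply: E2.
    rewrite exchange_big; apply: eq_bigr => t _.
    by rewrite scaler_sumr.
  rewrite -[X in P X](subrK (\sum_z io (G i z) * e z)); apply: idealD => //.
  rewrite E1 -sumrB; apply: ideal_sum => // t _; rewrite -scalerBr.
  by apply: idealZ => //; case: (Hal t).
have GS z : \sum_(i < M) a ^+ i * G i z = 0.
  have -> : \sum_(i < M) a ^+ i * G i z = \sum_x b x *: w x z.
    rewrite [RHS](eq_bigr (fun x => b (x.1, x.2) *: w (x.1, x.2) z)) => [|[] //].
    rewrite -(pair_bigA _ (fun i t => b (i, t) *: w (i, t) z)) /=.
    apply: eq_bigr => i _; rewrite /G valK mulr_sumr; apply: eq_bigr => t _.
    by rewrite scalerAr.
  apply: (@coef_box_eq0 dom); first by apply: degle_sum => x _; apply: degleZ.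
  move=> t; rewrite raddf_sum /= -[RHS](Hb (z, t)).
  by apply: eq_bigr => x _; rewrite mcoeffZ.
(* As in [grows_step]: modulo [P] only the layer [i = 0] survives, since [io a] is in [P]; then [a]
   cancels in the domain [A]. *)
have key m (p : nat -> E -> A) :
    (forall i, P (\sum_z io (p i z) * e z) -> forall z, p i z = 0) ->
    (forall z, \sum_(i < m) a ^+ i * p i z = 0) -> forall i, (i < m)%N -> forall z, p i z = 0.
  elim: m p => [//|m IH] p Hp Hs.
  pose q z := \sum_(i < m) a ^+ i * p i.+1 z.
  have Hq z : p 0%N z = - (a * q z).
    apply/eqP; rewrite -addr_eq0 -[X in X == _]/(p 0%N z + a * q z) -(Hs z) big_ord_recl expr0 mul1r.
    apply/eqP; congr (_ + _); rewrite mulr_sumr; apply: eq_bigr => i _.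
    by rewrite mulrA -exprS.
  have p0 : forall z, p 0%N z = 0.
    apply: Hp; apply: ideal_sum => // z _; rewrite Hq rmorphN rmorphM mulNr -mulrA.
    by apply: idealN => //; apply: ideal_mulr.
  case=> [//|i]; rewrite ltnS; apply: (IH (fun i => p i.+1)) => [j /Hp //|z].
  have := Hq z; rewrite p0 => /esym/eqP; rewrite oppr_eq0 mulf_eq0 (negbTE a0) => /eqP.
  exact.
case/eqP: bx; case: x0 => i t.
have Gz : forall z, G i z = 0.
  apply: (key M G _ GS _ (ltn_ord i)) => j /GP H z.
  by apply: big1 => u _; rewrite H scale0r.
have := GP i; rewrite valK; apply.
by rewrite big1 => [|z _]; [apply: ideal0 | rewrite Gz rmorph0 mul0r].
Qed.

Hypothesis Hy : forall i, y i \is 1.-homog.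

Lemma iota_alg_homog m (a : A) : a \is m.-homog -> io a \is m.-homog.
Proof.
move/dhomogP => Ha; rewrite [a]mpolyE rmorph_sum big_seq; apply: rpred_sum => mu Hmu.
have <- : mdeg mu = m by apply: Ha.
rewrite iota_algZ; apply: rpredZ; rewrite mpolyXE_id rmorph_prod mdegE.
elim/big_ind2: _ => [|p i q j|i _]; [exact: dhomog1 | exact: dhomogM |].
by rewrite rmorphXn iota_algX; move: (dhomogMn (mu i) (Hy i)); rewrite mul1n.
Qed.

Lemma pihomog_iota_alg m (a : A) : pihomog mdeg m (io a) = io (pihomog mdeg m a).
Proof.
rewrite {1}[a]sum_pihomog rmorph_sum raddf_sum /=.
have Hi (i : nat) : io (pihomog mdeg i a) \is i.-homog by apply/iota_alg_homog/pihomogP.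
have [lt_m|le_m] := ltnP m (msize a).
  rewrite (bigD1 (Ordinal lt_m)) //= pihomog_dE ?Hi // big1 ?addr0 // => i ni.
  by apply: (pihomog_ne0 _ (Hi i)); apply: contra_neq ni => E; apply: val_inj.
rewrite big1 => [|i _].
  suff -> : pihomog mdeg m a = 0 by rewrite rmorph0.
  rewrite pihomogE big_seq_cond; apply: big1 => mu /andP [/msize_mdeg_lt lt_m /eqP Em].
  by move: le_m; rewrite leqNgt -Em lt_m.
by apply: (pihomog_ne0 _ (Hi i)); rewrite ltn_eqF // (leq_trans (ltn_ord i)).
Qed.

Definition ideal_plus J f := exists q (h : 'I_s -> S), J q /\ f = q + \sum_j h j * y j.

Lemma ideal_plusP J : is_ideal J -> is_ideal (ideal_plus J).
Proof.
move=> HJ; split.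
- exists 0, (fun=> 0); split; first exact: ideal0.
  by rewrite add0r big1 // => j _; rewrite mul0r.
- move=> _ _ [q [h [Jq ->]]] [q' [h' [Jq' ->]]].
  exists (q + q'), (fun j => h j + h' j); split; first exact: idealD.
  rewrite addrACA; congr (_ + _); rewrite -big_split; apply: eq_bigr => j _.
  by rewrite mulrDl.
- move=> c _ [q [h [Jq ->]]]; exists (c * q), (fun j => c * h j).
  split; first exact: ideal_mull.
  by rewrite mulrDr mulr_sumr; congr (_ + _); apply: eq_bigr => j _; rewrite mulrA.
Qed.

Lemma ideal_plus_sub J f : J f -> ideal_plus J f.
Proof.
by move=> Jf; exists f, (fun=> 0); split=> //; rewrite big1 ?addr0 // => j _; rewrite mul0r.
Qed.

Lemma ideal_plus_mem J i : is_ideal J -> ideal_plus J (y i).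
Proof.
move=> HJ; exists 0, (fun j => (j == i)%:R); split; first exact: ideal0.
rewrite add0r (bigD1 i) //= eqxx mul1r big1 ?addr0 // => j /negbTE ->.
by rewrite mul0r.
Qed.

Lemma ideal_plus_iota J m (a : A) : is_ideal J -> (0 < m)%N -> a \is m.-homog ->
  ideal_plus J (io a).
Proof.
move=> HJ m0 /dhomogP Ha; have HP := ideal_plusP HJ.
rewrite [a]mpolyE rmorph_sum big_seq; apply: ideal_sum => // mu Hmu.
have Em : mdeg mu = m by apply: Ha.
have [i mi] : exists i, (0 < mu i)%N.
  apply: NNPP => H; move: m0; rewrite -Em mdegE lt0n => /eqP; apply.
  by apply: big1 => i _; apply/eqP; rewrite -leqn0 leqNgt; apply/negP => ?; apply: H; exists i.
rewrite iota_algZ; apply: idealZ => //; rewrite mpolyXE_id rmorph_prod (bigD1 i) //=.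
apply: ideal_mulr => //; rewrite iota_algXn iota_algX.
by apply: idealX => //; apply: ideal_plus_mem.
Qed.

(** A monomial of degree above [N * M] has an exponent at least [M], hence lies in [J + (y)]. A form
    of such degree is therefore, modulo [J], a combination of the [y j] with coefficients of degree
    one less, and induction on the degree applies; gradedness of [J] keeps the degrees exact. *)
Lemma nakayama J M : is_ideal J -> graded J ->
  (forall i, ideal_plus J ('X_i ^+ M)) ->
  spans_over J (fun mu : 'X_{1..N < (N * M).+1} => 'X_[mu] : S).
Proof.
move=> HJ gJ HX.
have HJy := ideal_plusP HJ; set Jy := ideal_plus J in HX HJy.
have big_mono (mu : 'X_{1..N}) : (N * M < mdeg mu)%N -> Jy 'X_[mu].
  move=> lt_mu; have [i le_M] : exists i, (M <= mu i)%N.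
    apply: NNPP => H; move: lt_mu; rewrite ltnNge => /negP; apply.
    rewrite mdegE; apply: leq_trans (_ : \sum_(i < N) M <= _)%N.
      by apply: leq_sum => i _; rewrite leqNgt; apply/negP => /ltnW Hi; apply: H; exists i.
    by rewrite sum_nat_const card_ord.
  rewrite mpolyXE_id (bigD1 i) //= -(subnK le_M) exprD -mulrA mulrCA.
  by apply: ideal_mulr => //; apply: HX.
have homJy m f : (N * M < m)%N -> f \is m.-homog -> Jy f.
  move=> lt_m /dhomogP Hf; rewrite [f]mpolyE big_seq.
  elim/big_ind: _ => [|p q|mu /Hf Emu]; [exact: ideal0 | exact: idealD |].
  by rewrite -mul_mpolyC; apply: ideal_mull => //; apply: big_mono; rewrite Emu.
have low m f : (m <= N * M)%N -> f \is m.-homog -> exists al : 'X_{1..N < (N * M).+1} -> A,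
    (forall x, degle m (al x)) /\ J (f - \sum_x io (al x) * 'X_[x]).
  move=> le_m Hf; exists (fun x => (f@_x)%:MP); split.
    by move=> x; rewrite -[_%:MP]mulr1 mul_mpolyC; apply/degleZ/degle1.
  have -> : f - \sum_(x : 'X_{1..N < (N * M).+1}) io (f@_x)%:MP * 'X_[x] = 0; last exact: ideal0.
  apply/eqP; rewrite subr_eq0; apply/eqP; rewrite {1}(@mpolywE _ _ (N * M).+1 f).
    by apply: eq_bigr => x _; rewrite iota_algC mul_mpolyC.
  by apply: leq_trans (degle_homog Hf) _.
have hom m f : f \is m.-homog -> exists al : 'X_{1..N < (N * M).+1} -> A,
    (forall x, degle m (al x)) /\ J (f - \sum_x io (al x) * 'X_[x]).
  elim: m f => [|m IH] f Hf; first exact: low Hf.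
  have [le_m|lt_m] := leqP m.+1 (N * M); first exact: low Hf.
  have [q [h [Jq Ef]]] := homJy _ _ lt_m Hf.
  have [be Hbe] := fun_choice (fun j => IH _ (pihomogP mdeg m (h j))).
  exists (fun x => \sum_j 'X_j * be j x); split.
    move=> x; apply: degle_sum => j _; apply: (degleM (a := 1)); last by case: (Hbe j).
    exact/degle_homog/dhomog_var.
  rewrite -(pihomog_dE Hf) Ef raddfD /= -addrA; apply: idealD => //; first exact: gJ.
  rewrite raddf_sum /=; under [X in _ - X]eq_bigr => x _ do rewrite (rmorph_sum io) mulr_suml.
  rewrite exchange_big -sumrB; apply: ideal_sum => // j _.
  rewrite (pihomogMr _ _ (Hy j)) /= subn1 /= mulrC.
  under eq_bigr => x _ do rewrite rmorphM iota_algX -mulrA.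
  by rewrite -mulr_sumr -mulrBr; apply: ideal_mull => //; case: (Hbe j).
move=> m f df.
have [al Hal] := fun_choice (fun d => hom d _ (pihomogP mdeg d f)).
exists (fun x => \sum_(d < m.+1) al d x); split.
  move=> x; apply: degle_sum => d _; apply: degleW ((Hal d).1 x); by rewrite -ltnS.
rewrite {1}(pihomog_partitionE df).
under [X in _ - X]eq_bigr => x _ do rewrite (rmorph_sum io) mulr_suml.
by rewrite exchange_big -sumrB; apply: ideal_sum => // d _; case: (Hal d).
Qed.

End Finite.

Lemma ex_last (P : nat -> Prop) B : P 0%N -> (forall r, P r -> (r <= B)%N) ->
  exists r, P r /\ ~ P r.+1.
Proof.
move=> P0 PB; apply: NNPP => H; suff : P B.+1 by move/PB; rewrite ltnn.
elim: B.+1 => // r Pr; apply: NNPP => nP; apply: H; by exists r.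
Qed.

Lemma expn_shift m b d : ((m + b) ^ d.+1 <= m ^ d.+1 + d.+1 * b * (m + b) ^ d)%N.
Proof.
elim: d => [|d IH]; first by rewrite !expn1 expn0 mul1n muln1.
rewrite expnS; apply: leq_trans (leq_mul (leqnn (m + b)) IH) _.
rewrite mulnDr mulnCA -[((m + b) * _ ^ d)%N]expnS [(_ * m ^ _)%N]mulnDl -expnS -addnA leq_add2l.
rewrite [(d.+2 * b)%N]mulSn [in X in (_ <= X)%N]mulnDl leq_add2r leq_mul2l.
by rewrite leq_exp2r ?leq_addr ?orbT.
Qed.

Lemma expn_le_bin m d : (m ^ d <= 'C(m + d, m) * d`!)%N.
Proof.
rewrite -(bin_sub (leq_addr d m)) addKn bin_ffact.
elim: d => [|d IH]; first by rewrite ffactn0.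
by rewrite addnS ffactSS expnS leq_mul // leqW // leq_addr.
Qed.

(** Leading terms are compared, [r * m ^ d / d!] against [delta * m ^ d / d!]; the shift by [b]
    affects lower order terms only. *)
Lemma lead_coef_bound (Pl : {poly rat}) d r delta b m0 : size Pl = d.+1 ->
  (delta%:R : rat) = (d`!)%:R * Pl`_d ->
  (forall m, (m0 <= m)%N -> ((r * 'C(m + d, m))%:R : rat) <= Pl.[(m + b)%:R]) ->
  (r <= delta)%N.
Proof.
move=> sP Ed HP; case: d sP Ed HP => [|d] sP Ed HP.
  have := HP m0 (leqnn _); rewrite (@horner_coef_wide _ 1) ?sP // big_ord1 expr0 mulr1.
  by rewrite addn0 binn muln1 -(ler_nat rat) Ed fact0 mul1r.
rewrite leqNgt; apply/negP => lt_r.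
pose Q := \poly_(i < d.+1) Pl`_i.
have [B HB] := @poly_bound ((d.+1)`!%:R *: Q) d (leq_trans (size_scale_leq _ _) (size_poly _ _)).
have PE x : Pl.[x] = Q.[x] + Pl`_d.+1 * x ^+ d.+1.
  rewrite (@horner_coef_wide _ d.+2) ?sP // big_ord_recr /=; congr (_ + _).
  rewrite /Q horner_poly; by [].
(* [K * (m + b) ^ d] bounds both errors: the part of [Pl] below its leading term and the shift from
   [m] to [m + b]. Since [m > K], the surplus [(m + b) ^ d.+1] coming from [r > delta] exceeds
   them. *)
pose K := (B * 2 ^ d + (r * d.+1 * b))%N; pose m := (m0 + b + K).+1.
have m0m : (m0 <= m)%N by rewrite /m; lia.
have := HP m m0m; rewrite PE -(ler_pM2l (x := (d.+1)`!%:R)); last by rewrite ltr0n fact_gt0.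
rewrite mulrDr mulrA -Ed -hornerZ => H.
have := le_trans H (lerD (HB (m + b)%N) (lexx _)).
rewrite -natrX -!natrM -natrD ler_nat leqNgt => /negP; apply.
set y := (m + b)%N.
have h1 := expn_le_bin m d.+1; have h2 := expn_shift m b d; rewrite -/y in h2.
have h3 : (B * y.+1 ^ d <= B * 2 ^ d * y ^ d)%N.
  rewrite -mulnA -expnMn leq_mul2l; case: (d) => [|d']; first by rewrite !expn0 orbT.
  by rewrite leq_exp2r // mul2n -addnn -addn1 leq_add2l orbT.
have h4 : (K * y ^ d < y * y ^ d)%N by rewrite ltn_pmul2r ?expn_gt0 /y /m; lia.
have h5 : (delta.+1 * y ^ d.+1 <= r * y ^ d.+1)%N by rewrite leq_mul2r lt_r orbT.
have h6 : (r * y ^ d.+1 <= r * (m ^ d.+1 + d.+1 * b * y ^ d))%N by rewrite leq_mul2l h2 orbT.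
have h7 : (r * m ^ d.+1 <= r * ('C(m + d.+1, m) * (d.+1)`!))%N by rewrite leq_mul2l h1 orbT.
rewrite -expnS in h4.
rewrite /K !mulnDl in h4; rewrite mulSn in h5; rewrite mulnDr !mulnA in h6.
rewrite [(_`! * _)%N]mulnC -[X in (_ < X)%N]mulnA.
move: h3 h4 h5 h6 h7; clear; lia.
Qed.

Section Normalization.
Variables (k : fieldType) (N : nat).
Local Notation S := {mpoly k[N]}.
Implicit Types (I J P : S -> Prop) (f g p q : S).

Lemma gen_cat_repr (g zs : seq S) f : gen_ideal (g ++ zs) f ->
  exists q (h : nat -> S), gen_ideal g q /\ f = q + \sum_(j < size zs) h j * zs`_j.
Proof.
elim/last_ind: zs f => [|zs z IH] f.
  by rewrite cats0 => H; exists f, (fun=> 0); rewrite big_ord0 addr0.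
rewrite -rcons_cat => /gen_rcons [_ [r [/IH [q [h [gq ->]]] ->]]].
exists q, (fun j => if j == size zs then r else h j); split=> //.
rewrite size_rcons big_ord_recr /= nth_rcons ltnn !eqxx -addrA; congr (_ + (_ + _)).
by apply: eq_bigr => i _; rewrite nth_rcons ltn_ord ltn_eqF.
Qed.

(** Generic linear forms cut [I] down to dimension 0, where every variable is nilpotent, and
    [nakayama] applies with the largest exponent. Injectivity of [A -> S/I], for proper [I], comes
    only with [torsion_free]. *)
Lemma noether_normalization I s : infinite_field k -> is_ideal I -> graded I ->
  dimle I s -> exists (y : 'I_s -> S) (M : nat), (forall i, y i \is 1.-homog) /\
    spans_over y I (fun mu : 'X_{1..N < M} => 'X_[mu] : S).
Proof.
move=> Hk HI gI dI; have [g Hg] := noetherian_mpoly HI.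
have [|zs [sz Hz Hd]] := @generic_linear k N Hk s [:: (g, s)].
  by move=> g' s' [[<- <-]|//]; apply: dimle_sub dI => p /Hg.
have := Hd g s (or_introl (erefl _)) s (leqnn _) (leqnn _).
rewrite subnn take_oversize ?sz // => d0.
have gJ : graded (gen_ideal (g ++ zs)).
  elim/last_ind: (zs) Hz => [_ f d|ws w IH Hw f d].
    by rewrite cats0 => /Hg/gI/Hg.
  rewrite -rcons_cat => /gen_rcons Hf; apply/gen_rcons.
  apply: (graded_add (gen_is_ideal _) _ (Hw w _)) Hf; last by rewrite mem_rcons mem_head.
  by apply: IH => z zw; apply: Hw; rewrite mem_rcons inE zw orbT.
have nil i : exists m, gen_ideal (g ++ zs) ('X_i ^+ m).
  by apply: nilpotent_mod => //; [apply: gen_is_ideal | exists 1%N => //; apply: dhomog_var].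
have [mm Hm] := fun_choice nil; pose M := \max_i mm i.
exists (fun i => zs`_i), (N * M).+1; split.
  by move=> i; apply: Hz; rewrite mem_nth // sz.
apply: nakayama => // [i|i]; first by apply: Hz; rewrite mem_nth // sz.
have le_m : (mm i <= M)%N by rewrite /M (bigD1 i) //= leq_maxl.
have [|q [h [gq E]]] := @gen_cat_repr g zs ('X_i ^+ M).
  by rewrite -(subnK le_m) exprD; apply: ideal_mull (Hm i); apply: gen_is_ideal.
exists q, (fun j => h j); split; first exact/Hg.
by rewrite E sz.
Qed.

End Normalization.

(** If [io a] kills a nonzero class, it lies in an associated prime [P]. Unmixedness gives [S/P]
    dimension [d.+1], while finiteness over [A] with [io a] in [P] forces growth below [d.+1]. *)
Lemma torsion_free (k : fieldType) (n d : nat) (I : {mpoly k[n.+1]} -> Prop)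
    (y : 'I_d.+1 -> {mpoly k[n.+1]}) (E : finType) (e : E -> {mpoly k[n.+1]}) :
  is_ideal I -> unmixed I -> proj_dim I d -> spans_over y I e ->
  forall a g, a != 0 -> I (iota_alg y a * g) -> I g.
Proof.
move=> HI HU [[C HC] Cmax] He a g a0 Iag; apply: NNPP => ng.
have [P [[HP [h Hh]] Pa]] := assoc_prime_ann (@noetherian_mpoly k n.+1) HI ng Iag.
have HP' : assoc_prime I P by split=> //; exists h.
have IP f : I f -> P f by move=> If; apply/Hh; apply: ideal_mulr.
case: (HC) => IC0 Cprime Cstep.
(* A longest chain above [I] starts above an associated prime [P0], which therefore has the
   dimension of [I]. *)
have [P0 [HP0 P0C]] := assoc_prime_below (@noetherian_mpoly k n.+1) HI (Cprime 0%N (leq0n _)) IC0.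
have IP0 f : I f -> P0 f by case: HP0 => _ [h0 H0] If; apply/H0; apply: ideal_mulr.
have dim0 : krull_dim_quot P0 d.+1.
  split; first by exists C; split.
  by move=> s D [P0D D1 D2]; apply: (Cmax s D); split=> // f /IP0/P0D.
(* [unmixed] only compares dimensions already known to exist, so [P] must first be given one; its
   chains are bounded by those of [I]. *)
have [r [[D HD] nD]] : exists r, (exists D, prime_chain P r D) /\ ~ exists D, prime_chain P r.+1 D.
  apply: (@ex_last _ d.+1); first by exists (fun=> P); split=> // -[].
  by move=> r [D [PD D1 D2]]; apply: (Cmax r D); split=> // f /IP/PD.
have dimP : krull_dim_quot P r.
  split; first by exists D.
  move=> s D' [PD' D1 D2]; rewrite leqNgt; apply/negP => lt_rs; apply: nD.
  exists D'; split=> // i le_i; [apply: D1 | apply: D2]; lia.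
have iP : is_ideal P by case: HP.
have Er := HU _ _ _ _ HP' HP0 dimP dim0; rewrite Er in HD.
have := spans_over_grows iP (spans_over_sub (P := P) IP He) a0 Pa (chain_grows HD).
by rewrite ltnn.
Qed.

(** * Rank of [S/I] over [A], denominators and multiplication matrices *)

Section Rank.
Variables (k : fieldType) (n d : nat).
Local Notation S := {mpoly k[n.+1]}.
Local Notation A := {mpoly k[d.+1]}.
Variables (I : S -> Prop) (y : 'I_d.+1 -> S).
Hypotheses (HI : is_ideal I) (gI : graded I) (Hy : forall i, y i \is 1.-homog).
Local Notation io := (iota_alg y).

(** Linear independence over [A] in [S/I], not algebraic independence. *)
Definition alg_indep r (b : 'I_r -> S) :=
  forall c : 'I_r -> A, I (\sum_i io (c i) * b i) -> forall i, c i = 0.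

(** Multiplying the [b i] by the monomials of degree [m] of [A] gives [r * 'C(m + d, m)] independent
    forms of degree [m + be], a lower bound for the Hilbert polynomial at [m + be]. *)
Lemma rank_le_degree delta r be (b : 'I_r -> S) : ideal_degree I d delta ->
  (forall i, b i \is be.-homog) -> alg_indep b -> (r <= delta)%N.
Proof.
move=> [Pl [[m0 Hm] sP Ed]] Hb ib.
apply: (@lead_coef_bound Pl d r delta be m0 sP Ed) => m le_m.
have [R [HR ->]] := Hm (m + be)%N (leq_trans le_m (leq_addr _ _)); rewrite ler_nat.
pose sb := [seq s2m t | t : m.-tuple 'I_d.+1 <- enum (basis d.+1 m)].
have ssb : size sb = 'C(m + d, m) := size_basis d m.
rewrite -ssb -[r]card_ord -[size sb]card_ord -card_prod.
pose g (x : 'I_r * 'I_(size sb)) := io 'X_[nth 0%MM sb x.2] * b x.1.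
apply: (@indep_card k n.+1 I _ _ g _ HI _ _ (hilbert_spanned HI HR)).
  move=> c Hc [i j].
  pose a i := \sum_j c (i, j) *: 'X_[nth 0%MM sb j] : A.
  have a0 : a i = 0.
    apply: (ib a); move: Hc; congr I.
    rewrite (eq_bigr (fun x => c (x.1, x.2) *: g (x.1, x.2))) => [|[] //].
    rewrite -(pair_bigA _ (fun i j => c (i, j) *: g (i, j))) /=.
    apply: eq_bigr => i' _; rewrite raddf_sum mulr_suml; apply: eq_bigr => j' _.
    by rewrite /g scalerAl; congr (_ * _); rewrite -iota_algZ.
  have := congr1 (fun p : A => p@_(nth 0%MM sb j)) a0; rewrite mcoeff0 raddf_sum /=.
  rewrite (bigD1 j) //= mcoeffZ mcoeffX eqxx mulr1 big1 ?addr0 // => j' nj.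
  by rewrite mcoeffZ mcoeffX nth_uniq ?uniq_basis // (inj_eq val_inj) (negbTE nj) mulr0.
move=> [i j]; apply: dhomogM (Hb i); apply: iota_alg_homog => //.
by rewrite dhomogX basis_cover mem_nth.
Qed.

Hypothesis TF : forall a g, a != 0 -> I (io a * g) -> I g.

Lemma max_rank delta : ideal_degree I d delta -> exists r be (b : 'I_r -> S),
  [/\ (r <= delta)%N, forall i, b i \is be.-homog, alg_indep b &
      forall be' (b' : 'I_r.+1 -> S), (forall i, b' i \is be'.-homog) -> ~ alg_indep b'].
Proof.
move=> Hd; pose Pr r := exists be (b : 'I_r -> S), (forall i, b i \is be.-homog) /\ alg_indep b.
have [||r [[be [b [Hb ib]]] nr]] := @ex_last Pr delta.
- by exists 0%N, (fun=> 0); split=> [[]|c _ []].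
- by move=> r [be [b [Hb ib]]]; apply: rank_le_degree ib.
exists r, be, b; split=> //; first exact: rank_le_degree ib.
by move=> be' b' Hb' ib'; apply: nr; exists be', b'.
Qed.

Variables (r be : nat) (b : 'I_r -> S).
Hypotheses (Hb : forall i, b i \is be.-homog) (ib : alg_indep b)
  (bmax : forall be' (b' : 'I_r.+1 -> S), (forall i, b' i \is be'.-homog) -> ~ alg_indep b').

Lemma common_denominator1 q f : f \is q.-homog -> exists c (ga : 'I_r -> A),
  c != 0 /\ I (io c * f - \sum_i io (ga i) * b i).
Proof.
(* Powers of [y ord0] bring [f] and the [b i] to one degree, where maximality of [r] yields a
   relation; the coefficient of [f] is nonzero, since otherwise [b] would be dependent. *)
move=> Hf; pose u := (maxn be q - be)%N; pose v := (maxn be q - q)%N.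
pose b' (i : 'I_r.+1) := if unlift ord_max i is Some j then y ord0 ^+ u * b j else y ord0 ^+ v * f.
have hX w : y ord0 ^+ w \is w.-homog by have := dhomogMn w (Hy ord0); rewrite mul1n.
have Hb' i : b' i \is (maxn be q).-homog.
  rewrite /b'; case: unliftP => [j _|_].
    by have := dhomogM (hX u) (Hb j); rewrite /u subnK // leq_maxl.
  by have := dhomogM (hX v) Hf; rewrite /v subnK // leq_maxr.
apply: NNPP => H; apply: (bmax Hb') => c.
have liftE (j : 'I_r) : widen_ord (leqnSn r) j = lift ord_max j.
  by apply: val_inj; rewrite /= /bump leqNgt ltn_ord.
rewrite big_ord_recr /= /b' unlift_none => Hc.
pose X w : A := 'X_ord0 ^+ w.
have ioX w : io (X w) = y ord0 ^+ w by rewrite /X rmorphXn iota_algX.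
have X0 w : X w != 0.
  by rewrite expf_neq0 //; apply/eqP => /(congr1 (fun p : A => p@_U_(ord0))) /eqP; rewrite mcoeffX eqxx mcoeff0 oner_eq0.
have Hc' : I (io (c ord_max * X v) * f - \sum_i io (- (c (lift ord_max i) * X u)) * b i).
  move: Hc; congr I; rewrite addrC rmorphM ioX mulrA; congr (_ + _).
  rewrite -sumrN; apply: eq_bigr => i _.
  by rewrite !liftE liftK rmorphN rmorphM ioX mulNr opprK mulrA.
have cm : c ord_max = 0.
  apply: NNPP => /eqP cm; apply: H; exists (c ord_max * X v); eexists; split; last exact: Hc'.
  by rewrite mulf_neq0.
move: Hc'; rewrite cm mul0r rmorph0 mul0r sub0r -sumrN => Hc'.
have := @ib (fun i => c (lift ord_max i) * X u); move=> /(_ _)/= Hi i.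
have {}Hi : forall j, c (lift ord_max j) * X u = 0.
  apply: Hi; move: Hc'; congr I; apply: eq_bigr => j _; by rewrite rmorphN mulNr opprK.
case: (unliftP ord_max i) => [j ->|-> //].
by have /eqP := Hi j; rewrite mulf_eq0 (negbTE (X0 u)) orbF => /eqP.
Qed.

(** One homogeneous component of the relation is kept. Homogeneous denominators and numerators are
    what later gives [f_l] the exact degree [r]. *)
Lemma common_denominator1_homog f : f \is be.+1.-homog -> exists al c (ga : 'I_r -> A),
  [/\ c != 0, c \is al.-homog, forall i, ga i \is al.+1.-homog &
      I (io c * f - \sum_i io (ga i) * b i)].
Proof.
move=> Hf; have [c [ga [c0 H]]] := common_denominator1 Hf.
have [al ca] : exists al, pihomog mdeg al c != 0.
  apply: NNPP => Hn; case/eqP: c0; rewrite [c]sum_pihomog big1 // => i _.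
  by apply: NNPP => /eqP ni; apply: Hn; exists i.
exists al, (pihomog mdeg al c), (fun i => pihomog mdeg al.+1 (ga i)); split.
- exact: ca.
- exact: pihomogP.
- by move=> i; apply: pihomogP.
have E1 : pihomog mdeg (al + be.+1) (\sum_i io (ga i) * b i) =
    \sum_i io (pihomog mdeg al.+1 (ga i)) * b i.
  rewrite raddf_sum; apply: eq_bigr => i _.
  rewrite -[LHS]/(pihomog mdeg (al + be.+1) (io (ga i) * b i)).
  by rewrite (pihomogMr _ _ (Hb i)) addnS -addSn leq_addl addnK (pihomog_iota_alg Hy).
have := gI (al + be.+1) H.
by rewrite pihomogB (pihomogMr _ _ Hf) leq_addl addnK (pihomog_iota_alg Hy) E1.
Qed.

Definition combines c f (ga : 'I_r -> A) := I (io c * f - \sum_i io (ga i) * b i).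

Lemma combines_scale c' c f ga : combines c f ga -> combines (c' * c) f (fun i => c' * ga i).
Proof.
move/(ideal_mull (io c') HI); rewrite /combines mulrBr iota_algM mulrA [X in I (_ - X) -> _]mulr_sumr.
congr (I (_ - _)); apply: eq_bigr => i _; by rewrite iota_algM mulrA.
Qed.

Lemma combines_mul c f a ga : combines c f ga -> combines c (io a * f) (fun i => a * ga i).
Proof.
move/(ideal_mull (io a) HI); rewrite /combines mulrBr mulrCA [X in I (_ - X) -> _]mulr_sumr.
congr (I (_ - _)); apply: eq_bigr => i _; by rewrite iota_algM mulrA.
Qed.

Lemma combines_add c f g ga ga' : combines c f ga -> combines c g ga' ->
  combines c (f + g) (fun i => ga i + ga' i).
Proof.
move=> H H'; have := idealD HI H H'; rewrite /combines addrACA -mulrDr -opprD -big_split.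
congr (I (_ - _)); apply: eq_bigr => i _; by rewrite iota_algD mulrDl.
Qed.

Lemma combines0 c f : I f -> combines c f (fun=> 0).
Proof.
move=> If; rewrite /combines big1 => [|i _]; last by rewrite rmorph0 mul0r.
by rewrite subr0; apply: ideal_mull.
Qed.

Lemma common_denominator_homog (fs : seq S) : (forall f, f \in fs -> f \is be.+1.-homog) ->
  exists al c, [/\ c != 0, c \is al.-homog & forall f, f \in fs -> exists ga,
    (forall i, ga i \is al.+1.-homog) /\ combines c f ga].
Proof.
elim: fs => [_|f fs IH Hfs].
  by exists 0%N, 1; rewrite oner_neq0 dhomog1.
have [|al [c [c0 hc Hc]]] := IH; first by move=> g gs; apply: Hfs; rewrite inE gs orbT.
have [al' [c' [ga' [c0' hc' hga' Hc']]]] := common_denominator1_homog (Hfs f (mem_head _ _)).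
exists (al + al')%N, (c * c'); split; [exact: mulf_neq0 | exact: dhomogM |].
move=> g; rewrite inE => /orP[/eqP->|/Hc [ga [hga Hga]]].
  exists (fun i => c * ga' i); split; last exact: combines_scale.
  by move=> i; rewrite -addnS; apply: dhomogM.
exists (fun i => c' * ga i); split; last by rewrite [c * c']mulrC; apply: combines_scale.
by move=> i; rewrite addnC -addnS; apply: dhomogM.
Qed.

(** Finite generation over [A] gives one [c] for all [f]; applied to the powers of a linear form, it
    is the bound that complete integral closedness requires. *)
Lemma common_denominator (E : finType) (e : E -> S) : spans_over y I e ->
  (forall x, exists q, e x \is q.-homog) ->
  exists c, c != 0 /\ forall f, exists ga, combines c f ga.
Proof.
move=> He hom.
have [cc Hcc] : exists cc : E -> A, forall x, cc x != 0 /\ exists ga, combines (cc x) (e x) ga.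
  apply: (@fun_choice E A (fun x c => c != 0 /\ exists ga, combines c (e x) ga)) => x.
  by have [q /common_denominator1 [c [ga [c0 H]]]] := hom x; exists c; split=> //; exists ga.
exists (\prod_x cc x); split; first by apply/prodf_neq0 => x _; case: (Hcc x).
move=> f; have [al [_ Hal]] := He _ _ (degle_tdeg f).
have Hex x : exists ga, combines (\prod_x cc x) (e x) ga.
  have [_ [ga Hga]] := Hcc x; rewrite (bigD1 x) //= mulrC.
  by eexists; apply: combines_scale Hga.
have [ga Hga] : exists ga, combines (\prod_x cc x) (\sum_x io (al x) * e x) ga.
  move: (\prod_x cc x) Hex => D Hex.
  elim/big_ind: _ => [|g h [gg Hg] [gh Hh]|x _].
  - by exists (fun=> 0); apply: combines0; exact: ideal0 HI.
  - by exists (fun i => gg i + gh i); apply: combines_add.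
  - by have [ga Hga] := Hex x; exists (fun i => al x * ga i); apply: combines_mul.
rewrite -(subrK (\sum_x io (al x) * e x) f).
exists (fun i => 0 + ga i); exact: combines_add (combines0 _ Hal) Hga.
Qed.

Lemma mult_matrices : exists al a (C : 'I_n.+1 -> 'M[A]_r),
  [/\ a != 0, a \is al.-homog, forall t i j, C t i j \is al.+1.-homog &
    forall t i, I (io a * 'X_t * b i - \sum_j io (C t i j) * b j)].
Proof.
pose fs := [seq 'X_x.1 * b x.2 | x : 'I_n.+1 * 'I_r].
have [|al [a [a0 ha Ha]]] := @common_denominator_homog fs.
  by move=> f /mapP [[t i] _ ->]; exact: (dhomogM (dhomog_var _ _) (Hb i)).
have memfs (x : 'I_n.+1 * 'I_r) : 'X_x.1 * b x.2 \in fs by apply: map_f; rewrite mem_enum.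
have [ga Hga] := fun_choice (fun x => Ha _ (memfs x)).
exists al, a, (fun t => \matrix_(i, j) ga (t, i) j); split=> // [t i j|t i].
  by rewrite mxE; case: (Hga (t, i)).
have [_] := Hga (t, i); rewrite /combines -[(t, i).1]/t mulrA; congr (I (_ - _)).
by apply: eq_bigr => j _; rewrite mxE.
Qed.

End Rank.

(** * Commuting matrices over a residue field *)

Section ResidueField.
Variables (R : comNzRingType) (P : R -> Prop).
Hypothesis HP : is_prime P.

Definition prime_pred : pred R := fun x => excluded_middle_informative (P x).

Lemma prime_predP x : reflect (P x) (x \in prime_pred).
Proof. exact: sumboolP. Qed.

Lemma prime_pred_idealr : idealr_closed prime_pred.
Proof.
case: HP => HI P1 _; split; first by apply/prime_predP; apply: ideal0.
  by apply/prime_predP.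
move=> a x y /prime_predP Px /prime_predP Py; apply/prime_predP.
by apply: idealD => //; apply: ideal_mull.
Qed.
HB.instance Definition _ := isIdealr.Build R prime_pred prime_pred_idealr.

Lemma prime_pred_prime : prime_idealr_closed prime_pred.
Proof.
move=> u v /prime_predP; case: HP => _ _ PM /PM [H|H]; apply/orP; [left|right]; exact/prime_predP.
Qed.
HB.instance Definition _ := isPrimeIdealrClosed.Build R prime_pred prime_pred_prime.

Definition prime_pred_ideal : prime_idealr R := prime_pred.
Local Notation Q := {ideal_quot prime_pred_ideal}.

Definition quot_unit : pred Q := fun x => excluded_middle_informative (exists z, z * x = 1).
Definition quot_inv (x : Q) : Q :=
  match excluded_middle_informative (exists z, z * x = 1) with
  | left H => proj1_sig (constructive_indefinite_description _ H)
  | right _ => x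
  end.

Lemma quot_mulVx : {in quot_unit, left_inverse 1 quot_inv *%R}.
Proof.
move=> x; rewrite unfold_in /quot_inv /quot_unit; case: excluded_middle_informative => // H _.
exact: (proj2_sig (constructive_indefinite_description _ H)).
Qed.
Lemma quot_unitPl (x z : Q) : z * x = 1 -> x \in quot_unit.
Proof.
move=> H; rewrite unfold_in /quot_unit; case: excluded_middle_informative => // nH.
by case: nH; exists z.
Qed.
Lemma quot_inv_out : {in [predC quot_unit], quot_inv =1 id}.
Proof.
move=> x /negP nx; rewrite /quot_inv; case: excluded_middle_informative => // H.
by case: nx; apply/sumboolP.
Qed.
HB.instance Definition _ := GRing.ComNzRing_hasMulInverse.Build Q quot_mulVx quot_unitPl quot_inv_out.
HB.instance Definition _ := GRing.ComUnitRing_isIntegral.Build Q (@Quotient.rquot_IdomainAxiom R prime_pred_ideal).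

Lemma residue_field : exists (E : fieldType) (phi : {rmorphism R -> E}),
  forall x, phi x = 0 <-> P x.
Proof.
exists {fraction Q}, (@FracField.tofrac Q \o \pi_Q%qT) => x /=.
have E : (\pi_Q%qT x == 0 :> Q) = (x \in prime_pred).
  by rewrite -[x in RHS]subr0 -Quotient.equivE piE.
split=> [/eqP|/prime_predP]; first by rewrite tofrac_eq0 E => /prime_predP.
by rewrite -E => /eqP H; apply/eqP; rewrite tofrac_eq0; apply/eqP.
Qed.
End ResidueField.

Lemma scalar_sub_comm (R : comNzRingType) r (x z : R) (A B : 'M[R]_r) :
  A *m B = B *m A -> (x%:M - A) *m (z%:M - B) = (z%:M - B) *m (x%:M - A).
Proof.
move=> AB; rewrite !mulmxBl !mulmxBr !mul_scalar_mx !mul_mx_scalar AB !scale_scalar_mx.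
rewrite (mulrC z) !opprB addrACA [RHS]addrACA; congr (_ + _).
exact: addrC.
Qed.

Lemma infinite_uniq (k : fieldType) m : infinite_field k ->
  exists s : seq k, uniq s /\ size s = m.
Proof.
move=> Hk; elim: m => [|m [s [us ss]]]; first by exists [::].
have [x Hx] : exists x, x \notin s.
  apply: NNPP => H; apply: Hk; exists s => x; apply: contra_notT H => Hx; by exists x.
by exists (x :: s); rewrite /= Hx us ss.
Qed.

(* For fixed commuting M, N without common kernel in V, the kernels of the
   pencil M + x N in V form a direct sum, so only finitely many are nonzero. *)
Section CommonKernel.
Variables (k E : fieldType) (phi : {rmorphism k -> E}) (r : nat).
Hypothesis Hk : infinite_field k.

Lemma pencil_kernel (V : 'M[E]_r) (M N : 'M[E]_r) :
  M *m N = N *m M -> (V *m M <= V)%MS -> (V *m N <= V)%MS ->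
  (forall x : k, exists v : 'rV[E]_r,
      [/\ v != 0, (v <= V)%MS & v *m (M + phi x *: N) = 0]) ->
  exists v : 'rV[E]_r, [/\ v != 0, (v <= V)%MS, v *m M = 0 & v *m N = 0].
Proof.
move=> MN VM VN H; apply: NNPP => Hn.
have ker0 (v : 'rV[E]_r) : (v <= V)%MS -> v *m M = 0 -> v *m N = 0 -> v = 0.
  by move=> vV vM vN; apply: NNPP => /eqP v0; apply: Hn; exists v.
have direct (s : seq k) (w : k -> 'rV[E]_r) : uniq s ->
    (forall x, (w x <= V)%MS /\ w x *m (M + phi x *: N) = 0) ->
    \sum_(x <- s) w x = 0 -> forall x, x \in s -> w x = 0.
  elim: s w => // y s IH w /= /andP [ys us] Hw; rewrite big_cons => Hs.
  (* Multiplying by [M + phi y *: N] kills the term of [y] and turns each other [w x] into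
     [w x *m ((phi y - phi x) *: N)], again in the kernel for [x]. *)
  have Hs' : \sum_(x <- s) w x *m ((phi y - phi x) *: N) = 0.
    have := congr1 (mulmx^~ (M + phi y *: N)) Hs; rewrite mul0mx mulmxDl (Hw y).2 add0r.
    rewrite mulmx_suml => E0; rewrite -[RHS]E0; apply: eq_bigr => x _.
    have -> : M + phi y *: N = (M + phi x *: N) + (phi y - phi x) *: N.
      by rewrite scalerBl -addrA [phi x *: N + _]addrC subrK.
    by rewrite [RHS]mulmxDr (Hw x).2 add0r.
  have ws x : x \in s -> w x = 0.
    move=> xs; have := IH (fun x => w x *m ((phi y - phi x) *: N)) us _ Hs' x xs.
    have comm x' : (M + phi x' *: N) *m N = N *m (M + phi x' *: N).
      by rewrite mulmxDl mulmxDr MN -scalemxAl -scalemxAr.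
    move=> /(_ _) HH; have {HH} : w x *m ((phi y - phi x) *: N) = 0.
      apply: HH => z; have [wV w0] := Hw z; split.
        rewrite -scalemxAr; apply: scalemx_sub; exact: submx_trans (submxMr _ wV) VN.
      by rewrite -scalemxAr -scalemxAl -mulmxA -comm mulmxA w0 mul0mx scaler0.
    rewrite -scalemxAr => /eqP; rewrite scaler_eq0 subr_eq0 fmorph_eq => /orP[/eqP E1|/eqP wN].
      by rewrite E1 xs in ys.
    have [wV w0] := Hw x; apply: ker0 => //.
    by move: w0; rewrite mulmxDr -scalemxAr wN scaler0 addr0.
  move=> x; rewrite inE => /orP[/eqP->|/ws //].
  by move: Hs; rewrite big1_seq ?addr0 // => z /andP [_ /ws].
have [v Hv] := fun_choice H.
(* One more parameter than the dimension [r], so the kernel vectors are dependent, against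
   [direct]. *)
have [s [us ss]] := infinite_uniq r.+1 Hk.
have [|c [[i ci] Hc]] := @exists_relation E 'I_r.+1 'I_r (fun i j => v s`_i 0 j).
  by rewrite !card_ord.
pose w x := (if (index x s < r.+1)%N then c (inord (index x s)) else 0) *: v x.
have Ew (j : 'I_r.+1) : w s`_j = c j *: v s`_j.
  by rewrite /w index_uniq ?ss ?ltn_ord // inord_val.
have w0 : w s`_i = 0.
  apply: (direct s) => // [x||]; last by rewrite mem_nth // ss.
    have [_ vV v0] := Hv x; split; first exact: scalemx_sub.
    by rewrite -scalemxAl v0 scaler0.
  apply/rowP => j; rewrite (big_nth 0) ss big_mkord summxE mxE -[RHS](Hc j).
  by apply: eq_bigr => l _; rewrite Ew mxE.
have [v0 _ _] := Hv s`_i; move: w0; rewrite Ew => /eqP.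
by rewrite scaler_eq0 (negbTE ci) (negbTE v0).
Qed.

(** Induction on [m]: by [pencil_kernel] the hypothesis persists on the part of [V] killed by the
    last matrix, and commutation keeps that part stable. *)
Lemma common_kernel m (N : nat -> 'M[E]_r) (V : 'M[E]_r) :
  (forall i j, N i *m N j = N j *m N i) -> (forall i, (V *m N i <= V)%MS) ->
  (forall u : nat -> k, exists v : 'rV[E]_r,
     [/\ v != 0, (v <= V)%MS & v *m (\sum_(i < m) phi (u i) *: N i) = 0]) ->
  exists v : 'rV[E]_r, [/\ v != 0, (v <= V)%MS & forall i, (i < m)%N -> v *m N i = 0].
Proof.
move=> HN; elim: m V => [|m IH] V HV H.
  by have [v [v0 vV _]] := H (fun=> 0); exists v.
pose K := kermx (N m); pose V' := (V :&: K)%MS.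
have KN (v : 'rV[E]_r) : (v <= K)%MS = (v *m N m == 0) by apply/sub_kermxP/eqP.
have [||v [v0 vV' Hv]] := IH V'.
- move=> i; rewrite sub_capmx (submx_trans (submxMr _ (capmxSl _ _)) (HV i)) /=.
  apply/sub_kermxP; rewrite -mulmxA HN mulmxA.
  by have /sub_kermxP -> : (V' <= K)%MS := capmxSr _ _; rewrite mul0mx.
- move=> u; pose M := \sum_(i < m) phi (u i) *: N i.
  have [||||v [v0 vV vM vN]] := @pencil_kernel V M (N m).
  + rewrite /M mulmx_suml mulmx_sumr; apply: eq_bigr => i _.
    by rewrite -scalemxAl -scalemxAr HN.
  + rewrite /M mulmx_sumr; apply: summx_sub => i _.
    by rewrite -scalemxAr; apply: scalemx_sub.
  + exact: HV.
  + move=> x; have [v [v0 vV Hv]] := H (fun i => if i == m then x else u i).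
    exists v; split=> //; move: Hv; rewrite big_ord_recr /= eqxx => Hv.
    rewrite -[RHS]Hv; congr (_ *m (_ + _)); apply: eq_bigr => i _.
    by rewrite (ltn_eqF (ltn_ord i)).
  exists v; split=> //; by rewrite sub_capmx vV KN vN /=.
exists v; split=> // [|i]; first exact: submx_trans vV' (capmxSl _ _).
rewrite ltnS leq_eqVlt => /orP[/eqP->|/Hv //].
by apply/eqP; rewrite -KN; apply: submx_trans vV' (capmxSr _ _).
Qed.

End CommonKernel.

(** * Characteristic polynomials of linear forms *)

Section HomogPoly.
Variables (k : fieldType) (s : nat).
Local Notation A := {mpoly k[s]}.
Implicit Types (a g : A) (p q : {poly A}).

Lemma homog_factor a g u w : a != 0 -> a \is u.-homog -> a * g \is w.-homog ->
  if (u <= w)%N then g \is (w - u).-homog else g == 0.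
Proof.
move=> a0 Ha Hag.
have comp v : (v + u != w)%N -> pihomog mdeg v g = 0.
  move=> nv; have := pihomogMr g (v + u) Ha; rewrite leq_addl addnK mulrC => E.
  have := pihomog_ne0 (b := (v + u)%N) _ Hag; rewrite eq_sym => /(_ nv); rewrite E => /eqP.
  by rewrite mulf_eq0 (negbTE a0) orbF => /eqP.
case: leqP => [le_uw|lt_wu].
  rewrite [g]sum_pihomog; apply: rpred_sum => i _.
  have [<-|ni] := eqVneq (i + u)%N w; first by rewrite addnK; apply: pihomogP.
  by rewrite (comp _ ni) dhomog0.
apply/eqP; rewrite [g]sum_pihomog big1 // => i _; apply: comp.
by rewrite gtn_eqF // ltn_addl.
Qed.

(* Homogeneity of degree [e] in A[T] for the grading where T has degree 1. *)
Definition homog_uni e p := forall i,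
  if (i <= e)%N then p`_i \is (e - i).-homog else p`_i == 0.

Lemma homog_uni_coef e p i : homog_uni e p -> p`_i != 0 -> (i <= e)%N /\ p`_i \is (e - i).-homog.
Proof. by move=> /(_ i); case: leqP => // _ ->. Qed.

Lemma homog_uni0 e : homog_uni e 0.
Proof. by move=> i; rewrite coef0; case: ifP => // _; apply: dhomog0. Qed.

Lemma homog_uniD e p q : homog_uni e p -> homog_uni e q -> homog_uni e (p + q).
Proof.
move=> Hp Hq i; have := Hq i; have := Hp i; rewrite coefD; case: ifP => _.
  exact: dhomogD.
by move=> /eqP-> /eqP->; rewrite addr0.
Qed.

Lemma homog_uniN e p : homog_uni e p -> homog_uni e (- p).
Proof.
move=> Hp i; have := Hp i; rewrite coefN; case: ifP => _; last by rewrite oppr_eq0.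
by rewrite dhomogN.
Qed.

Lemma homog_uniM e e' p q : homog_uni e p -> homog_uni e' q -> homog_uni (e + e') (p * q).
Proof.
move=> Hp Hq i; rewrite coefM.
have H (j : 'I_i.+1) : p`_j * q`_(i - j) = 0 \/
    (i <= e + e')%N /\ p`_j * q`_(i - j) \is (e + e' - i).-homog.
  have [->|p0] := eqVneq p`_j 0; first by left; rewrite mul0r.
  have [->|q0] := eqVneq q`_(i - j) 0; first by left; rewrite mulr0.
  have [le_j hp] := homog_uni_coef Hp p0; have [le_ij hq] := homog_uni_coef Hq q0.
  have lt_j := ltn_ord j; right; split; first by lia.
  have -> : (e + e' - i = (e - j) + (e' - (i - j)))%N by lia.
  exact: dhomogM.
case: leqP => [le_i|lt_i].
  apply: rpred_sum => j _; case: (H j) => [->|[] //]; exact: dhomog0.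
by rewrite big1 // => j _; case: (H j) => [//|[]]; rewrite leqNgt lt_i.
Qed.

Lemma homog_uniC e a : a \is e.-homog -> homog_uni e a%:P.
Proof.
move=> Ha [|i]; first by rewrite coefC eqxx subn0.
by rewrite coefC /=; case: ifP => // _; apply: dhomog0.
Qed.

Lemma homog_uniX : homog_uni 1 'X.
Proof. by move=> [|[|i]]; rewrite coefX /= ?dhomog0 ?dhomog1. Qed.

Lemma homog_uni_det r e (M : 'M[{poly A}]_r) : (forall i j, homog_uni e (M i j)) ->
  homog_uni (r * e) (\det M).
Proof.
move=> HM; have -> : (r * e)%N = (0 + r * e)%N by [].
rewrite /determinant; elim/big_ind: _ => [|p q|w _]; [exact: homog_uni0 | exact: homog_uniD |].
apply: homog_uniM.
  rewrite -signr_odd; case: (odd _); rewrite ?expr1 ?expr0; [apply: homog_uniN|];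
  by apply: homog_uniC; apply: dhomog1.
have -> : (r * e)%N = (\sum_(i < r) e)%N by rewrite sum_nat_const card_ord.
elim/big_ind2: _ => [|p u q v|i _]; [|exact: homog_uniM | exact: HM].
by apply: homog_uniC; apply: dhomog1.
Qed.

Lemma homog_uni_factor a f u e : a != 0 -> a \is u.-homog ->
  homog_uni (u + e) (a%:P * f) -> homog_uni e f.
Proof.
move=> a0 Ha H i; have := H i; rewrite coefCM.
case: leqP => [le_i|lt_i]; last first.
  rewrite mulf_eq0 (negbTE a0) /= => /eqP ->; case: ifP => // _; exact: dhomog0.
move/(homog_factor a0 Ha); case: (leqP i e) => [le_ie|lt_ei].
  by rewrite ifT; [have -> : (u + e - i - u = e - i)%N by lia | lia].
by rewrite ifF //; lia.
Qed.

End HomogPoly.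

Section CharPoly.
Variables (R : comNzRingType) (r : nat).
Implicit Types (a : R) (C : 'M[R]_r).

Definition pencil a C : 'M[{poly R}]_r := (a%:P * 'X)%:M - map_mx polyC C.

Lemma det_pencil_lead a C : (\det (pencil a C))`_r = a ^+ r.
Proof.
have -> : pencil a C = map_mx (comp_poly (a%:P * 'X)) (char_poly_mx C).
  apply/matrixP => i j; rewrite !mxE rmorphB rmorphMn /= comp_polyX comp_polyC.
  by [].
rewrite det_map_mx -[LHS]/((char_poly C \Po (a%:P * 'X))`_r) comp_polyE size_char_poly coef_sum.
rewrite (bigD1 ord_max) //= big1 ?addr0 => [|i ni].
  rewrite coefZ exprMn -rmorphXn coefCM coefXn eqxx mulr1.
  by have := char_poly_monic C; rewrite monicE lead_coefE size_char_poly => /eqP ->; rewrite mul1r.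
rewrite coefZ exprMn -rmorphXn coefCM coefXn.
have /negbTE -> : r != i by apply: contra_neq ni => E; apply: val_inj.
by rewrite !mulr0.
Qed.

End CharPoly.

(* If all powers of C/a have the common denominator c, then a^r divides
   det (a T - C): A[T] is completely integrally closed. *)
Lemma det_pencil_div (k : fieldType) s r (a c : {mpoly k[s]}) (C : 'M[{mpoly k[s]}]_r) :
  a != 0 -> c != 0 ->
  (forall j, exists G, c *: C ^+ j = a ^+ j *: G) ->
  exists f, \det (pencil a C) = (a ^+ r)%:P * f.
Proof.
move=> a0 c0 Hj; set M := pencil a C.
pose PC := map_mx (@polyC {mpoly k[s]}) : 'M_r -> 'M_r.
(* The factor [C ^+ p] makes the induction pass: [C ^+ p * M ^+ j.+1] is [a T * C ^+ p * M ^+ j - C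
   ^+ p.+1 * M ^+ j]. *)
have step j p : exists G, c%:P *: (PC (C ^+ p) *m M ^+ j) = (a ^+ (j + p))%:P *: G.
  elim: j p => [|j IH] p.
    have [G HG] := Hj p; exists (PC G).
    by rewrite expr0 mulmx1 add0n /PC -!map_mxZ HG.
  have [G HG] := IH p; have [G' HG'] := IH p.+1.
  exists ('X *: G - G'); rewrite exprS mulmxA mulmxBr mulmxBl scalerBr scalerBr.
  congr (_ - _).
    rewrite mul_mx_scalar -scalemxAl scalerA mulrC -scalerA HG !scalerA; congr (_ *: _).
    by rewrite addSn exprS polyCM; ring.
  rewrite -map_mxM -[C ^+ p *m C]/(C ^+ p * C) -exprSr HG'; congr (_ *: _).
  by rewrite addSnnS.
have detX j : \det (M ^+ j) = \det M ^+ j.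
  by elim: j => [|j IH]; rewrite ?expr0 ?det1 // !exprS det_mulmx IH.
apply: (@cic_poly _ (@cic_mpoly k s) (a ^+ r)%:P (\det M) (c ^+ r)%:P).
- by rewrite polyC_eq0 expf_neq0.
- by rewrite polyC_eq0 expf_neq0.
(* Determinants turn [c M^j = a^j G] into [c^r (det M)^j = (a^r)^j det G], the hypothesis of
   [cic]. *)
move=> j; have [G HG] := step j 0%N; exists (\det G).
have := congr1 determinant HG; rewrite !detZ addn0 expr0 /PC map_mx1 mul1mx detX => E.
by rewrite polyC_exp E -!polyC_exp -!exprM mulnC.
Qed.

Section Projection.
Variables (k : fieldType) (n d : nat).
Local Notation S := {mpoly k[n.+1]}.
Local Notation A := {mpoly k[d.+1]}.
Variables (I : S -> Prop) (y : 'I_d.+1 -> S).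
Hypotheses (HI : is_ideal I) (gI : graded I) (Hy : forall i, y i \is 1.-homog).
Local Notation io := (iota_alg y).
Hypothesis TF : forall a g, a != 0 -> I (io a * g) -> I g.
Variables (r : nat) (b : 'I_r -> S).
Hypothesis ib : alg_indep I y b.

(** Row [i] of [G] holds the coordinates of [f * b i], so a product of elements acts by the matrix
    product in reverse order. *)
Definition acts_by (f : S) (G : 'M[A]_r) :=
  forall i, I (f * b i - \sum_j io (G i j) * b j).

Lemma acts_by_uniq f G G' : acts_by f G -> acts_by f G' -> G = G'.
Proof.
move=> H H'; apply/matrixP => i j; apply/eqP; rewrite -subr_eq0; apply/eqP.
apply: (ib (c := fun j => G i j - G' i j)).
have := idealB HI (H' i) (H i).
rewrite opprB addrC.
rewrite addrA subrK.
congr I; rewrite -sumrB; apply: eq_bigr => l _.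
by rewrite iota_algD iota_algN mulrBl.
Qed.

Lemma acts_byD f g G H : acts_by f G -> acts_by g H -> acts_by (f + g) (G + H).
Proof.
move=> HG HH i; have := idealD HI (HG i) (HH i).
rewrite addrACA -mulrDl -opprD -big_split; congr (I (_ - _)); apply: eq_bigr => j _.
by rewrite mxE iota_algD mulrDl.
Qed.

Lemma acts_byM f g G H : acts_by f G -> acts_by g H -> acts_by (f * g) (H *m G).
Proof.
move=> HG HH i.
have H1 := ideal_mull f HI (HH i).
have H2 : I (\sum_j io (H i j) * (f * b j - \sum_l io (G j l) * b l)).
  apply: (ideal_sum _ HI) => j _; exact: (ideal_mull _ HI (HG j)).
have := idealD HI H1 H2; congr I.
rewrite mulrBr mulrA -addrA; congr (_ + _).
pose Z j := \sum_l io (G j l) * b l.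
have -> : \sum_j io (H i j) * (f * b j - Z j) =
    f * (\sum_j io (H i j) * b j) - \sum_j io (H i j) * Z j.
  rewrite [f * _]mulr_sumr -sumrB; apply: eq_bigr => j _; by rewrite mulrBr [f * (_ * _)]mulrCA.
rewrite addrA addNr sub0r; congr (- _).
transitivity (\sum_j \sum_l io (H i j * G j l) * b l).
  apply: eq_bigr => j _; rewrite mulr_sumr; apply: eq_bigr => l _.
  by rewrite iota_algM mulrA.
rewrite exchange_big; apply: eq_bigr => l _; rewrite mxE -mulr_suml.
by congr (_ * _); rewrite raddf_sum.
Qed.

Lemma acts_by_iota a : acts_by (io a) a%:M.
Proof.
move=> i; rewrite (bigD1 i) //= big1 => [|j ni].
  by rewrite mxE eqxx addr0 subrr; apply: ideal0.
by rewrite mxE eq_sym (negbTE ni) mulr0n rmorph0 mul0r.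
Qed.

Lemma acts_byZ a f G : acts_by f G -> acts_by (io a * f) (a *: G).
Proof. by move=> H; rewrite -mul_mx_scalar; apply: acts_byM; first exact: acts_by_iota. Qed.

Lemma acts_byX f G j : acts_by f G -> acts_by (f ^+ j) (G ^+ j).
Proof.
move=> H; elim: j => [|j IH]; last by rewrite exprSr exprS; apply: acts_byM.
by rewrite !expr0 -(rmorph1 io); apply: acts_by_iota.
Qed.

Lemma acts_by0 f : I f -> acts_by f 0.
Proof.
move=> If i; rewrite big1 => [|j _]; last by rewrite mxE rmorph0 mul0r.
by rewrite subr0; apply: ideal_mulr.
Qed.

Variables (al : nat) (a c : A) (C : 'I_n.+1 -> 'M[A]_r).
Hypotheses (a0 : a != 0) (Ha : a \is al.-homog)
  (HC : forall t i j, C t i j \is al.+1.-homog)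
  (Cmul : forall t, acts_by (io a * 'X_t) (C t))
  (c0 : c != 0) (Hc : forall f, exists ga : 'I_r -> A, I (io c * f - \sum_i io (ga i) * b i)).

(** Both products represent [io a ^+ 2 * 'X_s * 'X_t], and a representing matrix is unique. *)
Lemma mult_comm s t : C s *m C t = C t *m C s.
Proof.
apply: (@acts_by_uniq (io a * 'X_s * (io a * 'X_t))); last exact: acts_byM.
by rewrite mulrC; apply: acts_byM.
Qed.

Section LinearForm.
Variable u : 'I_n.+1 -> k.
Definition linform : S := \sum_t u t *: 'X_t.
Definition linmat : 'M[A]_r := \sum_t (u t)%:MP *: C t.

Lemma linform_homog : linform \is 1.-homog.
Proof. by apply: rpred_sum => t _; apply/rpredZ/dhomog_var. Qed.

Lemma linmat_acts : acts_by (io a * linform) linmat.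
Proof.
rewrite /linform /linmat mulr_sumr; elim/big_ind2: _ => [|f G g H|t _].
- exact: acts_by0 (ideal0 HI).
- exact: acts_byD.
- have := acts_byZ (u t)%:MP (Cmul t); rewrite iota_algC mul_mpolyC -scalerAr //.
Qed.

Lemma linmat_homog i j : linmat i j \is al.+1.-homog.
Proof.
rewrite summxE; apply: rpred_sum => t _; rewrite mxE mul_mpolyC; apply: rpredZ; exact: HC.
Qed.

(** [c (a l)^j] is [a^j] times [c l^j], and [c l^j] already has a matrix over [A]. *)
Lemma linmat_powers j : exists G, c *: linmat ^+ j = a ^+ j *: G.
Proof.
have [ga Hga] := fun_choice (fun i => Hc (linform ^+ j * b i)).
exists (\matrix_(i, l) ga i l); apply: (@acts_by_uniq (io c * (io a * linform) ^+ j)).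
  exact/acts_byZ/acts_byX/linmat_acts.
rewrite exprMn mulrCA -iota_algXn; apply: acts_byZ => i; rewrite -mulrA.
by under eq_bigr => l _ do rewrite mxE.
Qed.

Lemma projection_poly : exists f : {poly A},
  [/\ homog_uni r f, f`_r = 1, I (\sum_(i < r.+1) io f`_i * linform ^+ i) &
   \det ((io a * linform)%:M - map_mx io linmat) =
     io a ^+ r * \sum_(i < r.+1) io f`_i * linform ^+ i].
Proof.
have [f Hf] := det_pencil_div a0 c0 linmat_powers.
have ar0 : a ^+ r != 0 by rewrite expf_neq0.
have hf : homog_uni r f.
  apply: (@homog_uni_factor _ _ (a ^+ r) f (al * r) r ar0 (dhomogMn r Ha)).
  (* The determinant has degree [r * al.+1]; removing the degree [al * r] of [a ^+ r] leaves [r] for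
     [f]. *)
  rewrite -Hf; have -> : (al * r + r = r * al.+1)%N by rewrite mulnS mulnC addnC.
  apply: homog_uni_det => i j; rewrite !mxE; apply: homog_uniD; last first.
    by apply/homog_uniN/homog_uniC/linmat_homog.
  case: (i == j); rewrite ?mulr0n ?mulr1n; last exact: homog_uni0.
  rewrite -[al.+1]addn1; exact: homog_uniM (homog_uniC Ha) (homog_uniX _ _).
have f1 : f`_r = 1.
  by apply: (mulfI ar0); rewrite mulr1 -[RHS](det_pencil_lead a linmat) Hf coefCM.
have szf : (size f <= r.+1)%N.
  by apply/leq_sizeP => i lt_i; have := hf i; rewrite leqNgt lt_i /= => /eqP.
pose ev : {rmorphism {poly A} -> S} := horner_eval linform \o map_poly io.
have evf : ev f = \sum_(i < r.+1) io f`_i * linform ^+ i.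
  rewrite /ev /= /horner_eval (@horner_coef_wide _ r.+1); last first.
    exact: leq_trans (size_poly _ _) szf.
  by apply: eq_bigr => i _; rewrite coef_map.
have evC x : ev x%:P = io x by rewrite /ev /= map_polyC /horner_eval hornerC.
have Edet : \det ((io a * linform)%:M - map_mx io linmat) = io a ^+ r * ev f.
  have -> : (io a * linform)%:M - map_mx io linmat = map_mx ev (pencil a linmat).
    apply/matrixP => i j; rewrite !mxE rmorphB evC rmorphMn rmorphM evC.
    by rewrite /ev /= map_polyX /horner_eval hornerX.
  by rewrite det_map_mx Hf rmorphM evC iota_algXn.
exists f; rewrite -evf; split=> //.
set W := _ - _ in Edet.
have Wb i : I (\sum_j W i j * b j).
  have := linmat_acts i; congr I.
  under [RHS]eq_bigr => j _ do rewrite !mxE mulrBl.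
  rewrite sumrB; congr (_ - _).
  rewrite (bigD1 i) //= eqxx mulr1n big1 ?addr0 // => j nj.
  by rewrite eq_sym (negbTE nj) mulr0n mul0r.
(* Cayley-Hamilton through the adjugate, since [W] kills the column of the [b i] modulo [I]. *)
have detb i : I (\det W * b i).
  have -> : \det W * b i = \sum_j (\adj W) i j * (\sum_l W j l * b l).
    have E := mul_adj_mx W.
    under [RHS]eq_bigr => j _ do rewrite mulr_sumr.
    rewrite exchange_big /= (bigD1 i) //= [X in _ + X]big1 => [|l nl].
      rewrite addr0; under eq_bigr => j _ do rewrite mulrA.
      rewrite -mulr_suml; congr (_ * _).
      by have /matrixP/(_ i i) := E; rewrite !mxE eqxx mulr1n => ->.
    under eq_bigr => j _ do rewrite mulrA.
    rewrite -mulr_suml; have /matrixP/(_ i l) := E; rewrite !mxE => ->.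
    by rewrite eq_sym (negbTE nl) mulr0n mul0r.
  apply: (ideal_sum _ HI) => j _; exact: (ideal_mull _ HI (Wb j)).
have fb i : I (ev f * b i).
  apply: (TF ar0); rewrite iota_algXn mulrA -Edet; exact: detb.
(* [ev f] kills all [b i]; as [io c] is a combination of them modulo [I], it kills [io c], which
   torsion-freeness cancels. *)
have [ga Hga] := Hc 1.
apply: (TF c0); have := ideal_mulr (ev f) HI Hga.
rewrite mulrBl mulr1 => H; rewrite -(subrK ((\sum_i io (ga i) * b i) * ev f) (io c * ev f)).
apply: (idealD HI H); rewrite mulr_suml; apply: (ideal_sum _ HI) => i _.
rewrite -mulrA [b i * _]mulrC; exact: (ideal_mull _ HI (fb i)).
Qed.

End LinearForm.

Hypothesis Hk : infinite_field k.

(** [P] is not yet known to contain [I], but [S/P] is already finite over [A]: for [l = 'X_t] the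
    monic form of [projection_poly] is in [I_r] and puts ['X_t ^+ r] into [P + (y)]. *)
Lemma spans_over_prime P : is_ideal P -> (forall g, g \is r.-homog -> I g -> P g) ->
  spans_over y P (fun mu : 'X_{1..n.+1 < (n.+1 * r).+1} => 'X_[mu] : S).
Proof.
move=> HP Pr.
(* [P] is not assumed homogeneous, so [nakayama] is applied to the graded ideal generated by
   [I_r]. *)
pose J p := exists gs : seq S, (forall g, g \in gs -> I g /\ g \is r.-homog) /\ gen_ideal gs p.
have HJ : is_ideal J.
  split; first by exists [::]; split=> //; apply/gen_nil.
  - move=> f g [gs [Hgs Hf]] [gs' [Hgs' Hg]]; exists (gs ++ gs'); split.
      by move=> h; rewrite mem_cat => /orP[/Hgs|/Hgs'].
    apply: idealD; first exact: gen_is_ideal.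
      by apply: gen_sub Hf => x; rewrite mem_cat => ->.
    by apply: gen_sub Hg => x; rewrite mem_cat orbC => ->.
  - by move=> x f [gs [Hgs Hf]]; exists gs; split=> //; apply: ideal_mull (gen_is_ideal _) Hf.
have gJ : graded J.
  move=> f e [gs [Hgs Hf]]; exists gs; split=> //; apply: graded_gen Hf => g /Hgs [_ Hg].
  by exists r.
apply: (@spans_over_sub _ _ _ _ J).
  by move=> f [gs [Hgs Hf]]; apply: gen_min Hf => // g /Hgs [Ig Hg]; apply: Pr.
apply: nakayama => // t.
pose u (t' : 'I_n.+1) : k := (t' == t)%:R.
have [f [hf f1 If _]] := projection_poly u.
have lu : linform u = 'X_t.
  rewrite /linform (bigD1 t) //= /u eqxx scale1r big1 ?addr0 // => t' /negbTE ->.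
  by rewrite scale0r.
rewrite lu in If; have HJy := ideal_plusP y HJ.
have hX i : ('X_t : S) ^+ i \is i.-homog.
  have H := dhomogMn i (dhomog_var k t); rewrite mul1n in H; exact: H.
have hsum : \sum_(i < r.+1) io f`_i * 'X_t ^+ i \is r.-homog.
  apply: rpred_sum => i _; have le_i : (i <= r)%N by rewrite -ltnS.
  have := hf i; rewrite le_i => /(iota_alg_homog Hy) Hi.
  by have := dhomogM Hi (hX i); rewrite subnK.
have Jsum : J (\sum_(i < r.+1) io f`_i * 'X_t ^+ i).
  exists [:: \sum_(i < r.+1) io f`_i * 'X_t ^+ i]; split.
    by move=> g; rewrite inE => /eqP ->.
  by apply: gen_mem; rewrite mem_head.
move: Jsum; rewrite big_ord_recr /= f1 rmorph1 mul1r => /(ideal_plus_sub y).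
apply: idealDr => //; apply: ideal_sum => // i _; apply: ideal_mulr => //.
have := hf i; rewrite ltnW ?ltn_ord //; apply: ideal_plus_iota => //.
by rewrite subn_gt0.
Qed.

(** A common kernel vector of the [N t] is a simultaneous eigenvector for the action on [S/I], with
    eigenvalues the classes in [Frac(S/P)]. Elements of [I] act by zero, so their classes vanish. *)
Lemma ideal_below_prime P s : is_prime P -> (forall g, g \is r.-homog -> I g -> P g) ->
  grows P s -> (d < s)%N -> subideal I P.
Proof.
move=> HP Pr Gs lt_ds; have iP : is_ideal P by case: HP.
(* This is where [d < s] enters: with [io a] in [P], finiteness over [A] would bound the growth of
   [P] by [d]. *)
have nPa : ~ P (io a).
  move=> Pa; have := spans_over_grows iP (spans_over_prime iP Pr) a0 Pa Gs.
  by rewrite ltnNge lt_ds.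
have [E [phi Hphi]] := residue_field HP.
pose psi : {rmorphism A -> E} := phi \o io.
pose phik : {rmorphism k -> E} := phi \o @mpolyC n.+1 k.
pose N t : 'M[E]_r := (phi (io a * 'X_t))%:M - map_mx psi (C t).
have Ncomm s1 s2 : N s1 *m N s2 = N s2 *m N s1.
  by apply: scalar_sub_comm; rewrite -!map_mxM mult_comm.
have psiE x : psi x = phi (io x) by [].
have phikE x : phik x = phi x%:MP by [].
have Nsum (u : 'I_n.+1 -> k) : \sum_t phik (u t) *: N t =
    map_mx phi ((io a * linform u)%:M - map_mx io (linmat u)).
  apply/matrixP => i j; rewrite summxE !mxE rmorphB rmorphMn.
  under eq_bigr => t _ do rewrite !mxE mulrBr.
  rewrite sumrB; congr (_ - _).
    have -> : io a * linform u = \sum_t (u t)%:MP * (io a * 'X_t).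
      rewrite /linform mulr_sumr; apply: eq_bigr => t _.
      by rewrite -scalerAr mul_mpolyC.
    rewrite raddf_sum -sumrMnl; apply: eq_bigr => t _.
    by rewrite mulrnAr; congr (_ *+ _); rewrite phikE -rmorphM.
  have -> : linmat u i j = \sum_t (u t)%:MP * C t i j.
    by rewrite summxE; apply: eq_bigr => t _; rewrite mxE.
  have -> : io (\sum_t (u t)%:MP * C t i j) = \sum_t io ((u t)%:MP * C t i j).
    exact: raddf_sum.
  rewrite raddf_sum; apply: eq_bigr => t _.
  by rewrite phikE -(iota_algC y) -rmorphM -iota_algM.
have [v [v0 _ Hv]] : exists v : 'rV[E]_r, [/\ v != 0, (v <= (1%:M : 'M[E]_r))%MS &
    forall i, (i < n.+1)%N -> v *m N (inord i) = 0].
  apply: (@common_kernel k E phik r Hk n.+1 (fun i => N (inord i)) 1%:M) => // [i|u].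
    exact: submx1.
  have -> : \sum_(i < n.+1) phik (u i) *: N (inord i) = \sum_(t < n.+1) phik (u t) *: N t.
    by apply: eq_bigr => i _; rewrite inord_val.
  rewrite (Nsum (fun t => u t)).
  have [f [hf f1 If Ef]] := projection_poly (fun t => u t).
  have d0 : \det (map_mx phi ((io a * linform (fun t => u t))%:M -
      map_mx io (linmat (fun t => u t)))) == 0.
    rewrite det_map_mx Ef rmorphM; apply/eqP.
    suff -> : phi (\sum_(i < r.+1) io f`_i * linform (fun t => u t) ^+ i) = 0 by rewrite mulr0.
    apply/Hphi/Pr => //; apply: rpred_sum => i _; have le_i : (i <= r)%N by rewrite -ltnS.
    have := hf i; rewrite le_i => /(iota_alg_homog Hy) Hi.
    have Hl := dhomogMn i (linform_homog (fun t => u t)); rewrite mul1n in Hl.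
    by have := dhomogM Hi Hl; rewrite subnK.
  by have /det0P [w w0 Hw] := d0; exists w; split=> //; apply: submx1.
(* Not every [f] maps the [A]-span of [b] to itself modulo [I], but for a form [g] of degree [m] the
   multiple [io a ^+ m * g] does; as [io a] is outside [P], this factor cancels at the end. *)
pose Q f := exists G, acts_by f G /\ v *m map_mx psi G = phi f *: v.
have QD f g : Q f -> Q g -> Q (f + g).
  move=> [G [HG EG]] [H [HH EH]]; exists (G + H); split; first exact: acts_byD.
  by rewrite map_mxD mulmxDr EG EH rmorphD scalerDl.
have QM f g : Q f -> Q g -> Q (f * g).
  move=> [G [HG EG]] [H [HH EH]]; exists (H *m G); split; first exact: acts_byM.
  by rewrite map_mxM mulmxA EH -scalemxAl EG scalerA rmorphM mulrC.
have Qio x : Q (io x).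
  exists x%:M; split; first exact: acts_by_iota.
  by rewrite map_scalar_mx mul_mx_scalar psiE.
have QX t : Q (io a * 'X_t).
  exists (C t); split; first exact: Cmul.
  have := Hv t (ltn_ord t); rewrite inord_val /N mulmxBr mul_mx_scalar => /eqP.
  by rewrite subr_eq0 => /eqP ->.
have Qmono (mu : 'X_{1..n.+1}) : Q (io a ^+ mdeg mu * 'X_[mu]).
  rewrite mpolyXE_id mdegE -prodrXr -big_split /=; elim/big_ind: _ => [|f g|i _].
  - by rewrite -(rmorph1 io); apply: Qio.
  - exact: QM.
  - rewrite -exprMn; elim: (mu i) => [|j IH]; last by rewrite exprS; apply: QM.
    by rewrite expr0 -(rmorph1 io); apply: Qio.
have Qhom m g : g \is m.-homog -> Q (io a ^+ m * g).
  move=> /dhomogP Hg; rewrite [g]mpolyE big_seq mulr_sumr.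
  elim/big_ind: _ => [|f h|mu Hmu]; [by rewrite -(rmorph0 io); apply: Qio | exact: QD |].
  have <- : mdeg mu = m by apply: Hg.
  by rewrite -mul_mpolyC -(iota_algC y) mulrCA; apply: QM (Qio _) (Qmono _).
move=> g Ig; apply: (gradedP iP) => m; set h := pihomog mdeg m g.
have Ih : I h by apply: gI.
have [G [HG EG]] := Qhom m h (pihomogP _ _ _).
have G0 : G = 0.
  by apply: (acts_by_uniq HG); apply: acts_by0; exact: (ideal_mull _ HI Ih).
move: EG; rewrite G0 map_mx0 mulmx0 => /esym/eqP; rewrite scaler_eq0 (negbTE v0) orbF => /eqP/Hphi.
by case: (HP) => _ _ PM /PM [/(primeX HP)|].
Qed.

(** Were [s > d], then [P] would contain [I], and [F], lying in [P] and regular modulo [I], would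
    push the growth of [I] above [d.+1]. *)
Lemma dim_prime P F : (forall s, grows I s -> (s <= d.+1)%N) -> nzd_mod I F ->
  is_prime P -> (forall g, g \is r.-homog -> I g -> P g) -> P F ->
  forall s, grows P s -> (s <= d)%N.
Proof.
move=> Idim HF HP Pr PF s Gs; rewrite leqNgt; apply/negP => lt_ds.
have IP := ideal_below_prime HP Pr Gs lt_ds.
have iP : is_ideal P by case: HP.
have := Idim _ (grows_step HI iP IP PF HF Gs); rewrite ltnS leqNgt => /negP; apply; exact: lt_ds.
Qed.

End Projection.

(** * Proof of the theorem *)

Lemma tdeg_homog (k : fieldType) n m (f : {mpoly k[n.+1]}) :
  f \is m.-homog -> (tdeg f <= m)%N.
Proof. by move=> /degle_homog; rewrite /degle /tdeg; case: (msize f). Qed.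

(** [dim_drop] is iterated on the prefix ideals; every prime above them contains [F], so the
    hypothesis controls those that also contain [W]. *)
Lemma generic_elements (k : fieldType) N (W : {mpoly k[N]} -> Prop) (F : {mpoly k[N]}) s c :
  infinite_field k -> subspace W ->
  (forall P, is_prime P -> P F -> subideal W P -> forall r, grows P r -> (r <= s)%N) ->
  dimle (gen_ideal [:: F]) (s + c) ->
  exists fs, [/\ size fs = c, forall f, f \in fs -> W f &
    forall i, (i <= c)%N -> dimle (gen_ideal (take i.+1 (F :: fs))) (s + c - i)].
Proof.
move=> Hk HW HP dF.
suff H j : (j <= c)%N -> exists fs, [/\ size fs = j, forall f, f \in fs -> W f &
    forall i, (i <= j)%N -> dimle (gen_ideal (take i.+1 (F :: fs))) (s + c - i)].
  exact: H.
elim: j => [_|j IH lt_jc].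
  by exists [::]; split=> // i; rewrite leqn0 => /eqP ->; rewrite subn0.
have [fs [sfs Wfs Hfs]] := IH (ltnW lt_jc).
pose J := gen_ideal (F :: fs).
have [|w Ww Hw] := @dim_drop _ _ W [:: (J, (s + c - j.+1)%N)] Hk HW.
  move=> _ _ [[<- <-]|//]; split; first exact: gen_is_ideal.
    have := Hfs j (leqnn _); rewrite take_oversize /= ?sfs //.
    by have -> : (s + c - j = (s + c - j.+1).+1)%N by lia.
  move=> P HPr JP WP r Gr; apply: leq_trans (HP P HPr _ WP r Gr) _; last by lia.
  by apply: JP; apply: gen_mem; rewrite mem_head.
exists (rcons fs w); split=> [|f|i].
- by rewrite size_rcons sfs.
- by rewrite mem_rcons inE => /orP[/eqP->|/Wfs].
rewrite leq_eqVlt ltnS => /orP[/eqP->|le_ij].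
  rewrite -rcons_cons take_oversize ?size_rcons /= ?sfs //.
  apply: dimle_sub (Hw J _ (or_introl (erefl _))) => p; exact: (gen_rcons _ _ _).2.
rewrite -rcons_cons -cats1 takel_cat /= ?sfs ?ltnS //; exact: Hfs.
Qed.

Theorem theorem3p1 (k : fieldType) (n d : nat) (I : {mpoly k[n.+1]} -> Prop)
  (F : {mpoly k[n.+1]}) (degI : nat) :
  infinite_field k -> perfect_field k ->
  homog_ideal I -> unmixed I -> is_radical I -> proj_dim I d ->
  ideal_degree I d degI ->
  homog_poly F -> nzd_mod I F ->
  exists fs : seq {mpoly k[n.+1]},
    [/\ size fs = (n - d)%N,
        forall f, f \in fs -> [/\ I f, homog_poly f &
          if d == 0%N then (tdeg f <= degI + tdeg F - 1)%N
          else (tdeg f <= 5 * d * tdeg F * degI)%N]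
      & regular_seq (F :: fs)].
Proof.
move=> Hk _ [HI gI] HU _ Hdim Hdeg HF Fnzd.
have I1 : ~ I 1.
  case: Hdim => [[C [IC HC _]] _] I1; have [_ C1 _] := HC 0%N (leq0n _).
  by apply: C1; apply: IC.
have F0 : F != 0.
  by apply/eqP => F0; apply: I1; apply: Fnzd; rewrite F0 mul0r; apply: ideal0.
have nzF : nzd_mod (gen_ideal [::]) F.
  move=> g /gen_nil/eqP; rewrite mulf_eq0 (negbTE F0) => /eqP ->; exact/gen_nil.
have F_homog : F \is (tdeg F).-homog := HF.
have [e0|e_gt0] := posnP (tdeg F).
  (* A nonzero constant [F] generates the unit ideal, modulo which every element is a
     non-zero-divisor, so zeros complete the sequence. *)
  exists (nseq (n - d) 0); rewrite size_nseq; split=> // [f|].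
    case/nseqP => -> _; split; first exact: ideal0.
      by apply/homogP; exists 0%N; apply: dhomog0.
    by rewrite /tdeg msize0 /=; case: ifP.
  have Funit : exists c, c != 0 /\ F = c%:MP.
    have := degle_homog F_homog; rewrite e0 => /msize1_polyC E.
    exists F@_0; split=> //; by apply: contra_neq F0 => E0; rewrite E E0 mpolyC0.
  have [c [c0 Fc]] := Funit.
  move=> [|i] lt_i; first exact: nzF.
  move=> g _; have <- : (g * c^-1%:MP) * F = g.
    by rewrite Fc -mulrA -mpolyCM mulVf // mpolyC1 mulr1.
  by apply: ideal_mull (gen_is_ideal _) _; apply: gen_mem; rewrite mem_head.
have [Pl [HPl sPl _]] := Hdeg.
have Idim s : grows I s -> (s <= d.+1)%N.
  by apply: (hilbert_poly_grows HI HPl); rewrite sPl.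
have [y [M [Hy Hspan]]] := noether_normalization Hk HI gI (dimle_grows Idim).
have TF := torsion_free HI HU Hdim Hspan.
have [r [be [b [le_r Hb ib bmax]]]] := max_rank HI Hy Hdeg.
have [al [a [C [a0 Ha HC Cmul]]]] := mult_matrices HI gI Hy Hb ib bmax.
have [|c [c0 Hc]] := common_denominator HI Hy Hb ib bmax Hspan.
  by move=> x; exists (mdeg x); rewrite dhomogX.
pose W (f : {mpoly k[n.+1]}) := I f /\ f \is r.-homog.
have HW : subspace W.
  split; first by split; [apply: ideal0 | apply: dhomog0].
  move=> u v x [Iu hu] [Iv hv]; split; first by apply: idealD => //; apply: idealZ.
  by apply: rpredD => //; apply: rpredZ.
have bound P : is_prime P -> P F -> subideal W P -> forall s, grows P s -> (s <= d)%N.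
  move=> HP PF WP; apply: (dim_prime HI gI Hy TF ib a0 Ha HC Cmul c0 Hc Hk Idim Fnzd HP) => //.
  by move=> g hg Ig; apply: WP.
have dF s : grows (gen_ideal [:: F]) s -> (s <= n)%N.
  move=> Gs; rewrite -ltnS; apply: (grows_leN (gen_is_ideal [::])).
  apply: (@grows_step k n.+1 _ (gen_ideal [:: F]) F) Gs; try exact: gen_is_ideal.
  + exact: gen_sub.
  + by apply: gen_mem; rewrite mem_head.
  + exact: nzF.
have [le_dn|lt_nd] := leqP d n; last first.
  (* Subtraction is truncated, so here the sequence is [F] alone. *)
  have -> : (n - d = 0)%N by lia.
  by exists [::]; split=> // -[|i] // _.
have [|fs [sfs Wfs Hfs]] := generic_elements (c := n - d) Hk HW bound.
  by rewrite subnKC //; apply: dimle_grows.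
rewrite subnKC // in Hfs; exists fs; split=> // [f fs_f|].
  have [If hf] := Wfs f fs_f; split=> //; first by apply/homogP; exists r.
  have le_f := leq_trans (tdeg_homog hf) le_r.
  (* Both bounds are at least [degI], as [tdeg F] is positive and so is [d] in the second case. *)
  case: eqP => [_|/eqP]; first by lia.
  rewrite -lt0n => d_gt0; apply: leq_trans le_f _; rewrite leq_pmull //.
  by rewrite !muln_gt0 d_gt0.
(* The exchange in [regular_of_dim] requires positive degrees. For [r = 0] the element [io c] would
   lie in [I], hence so would 1 by torsion-freeness. *)
have r_gt0 : (0 < r)%N.
  rewrite lt0n; apply/eqP => r0; apply: I1; apply: (TF c 1 c0).
  have [ga] := Hc 1; rewrite /combines big1 ?subr0 // => -[i lt_i] _.
  by exfalso; move: lt_i; rewrite r0.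
apply: regular_of_dim => //.
- by rewrite /= sfs ltnS leq_subr.
- move=> f; rewrite inE => /orP[/eqP->|/Wfs [_ hf]]; first by exists (tdeg F).
  by exists r.
- move=> [|t]; first by move=> _; rewrite take0 subn0; apply: dimle_grows => s; apply/grows_leN/gen_is_ideal.
  rewrite /= sfs ltnS => le_t; rewrite subSS; exact: Hfs.
Qed.
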